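(* Let $R$ and $S$ be associative rings and let ${}_SC_R$ be a semidualizing $(S,R)$-bimodule. An $S$-module $N$ belongs to $\mathcal{B}_C(S)$ if and only if there exists a complex of $S$-modules $$Y=\ \cdots\to W_1\to W_0\to I^0\to I^1\to\cdots$$ satisfying the following conditions: (a) the complex $Y$ is exact; (b) each $I^i$ is an injective $S$-module; (c) each $W_i$ is $C$-projective; (d) there is an isomorphism $N\cong\operatorname{Ker}(I^0\to I^1)$; and (e) the complex $\operatorname{Hom}_S(C,Y)$ is exact. The same equivalence holds with (c) replaced by the condition that each $W_i$ is $C$-flat. Moreover, if $N\in\mathcal{B}_C(S)$, then any complex $Y=\ \cdots\to W_1\to W_0\to I^0\to I^1\to\cdots$ constructed by splicing together (along $W_0\to N\to I^0$) an augmented injective coresolution of $N$ and an augmented proper $C$-projective resolution of $N$ satisfies conditions (a)–(e); that is, $Y$ is exact, each $I^i$ is an injective $S$-module, each $W_i$ is $C$-projective, $N\cong\operatorname{Ker}(I^0\to I^1)$, and $\operatorname{Hom}_S(C,Y)$ is exact.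
   Context: Rings are associative with unity (not necessarily commutative or noetherian). Modules are unital left modules; right $R$-modules are identified with left $R^{\mathrm{op}}$-modules. An $(S,R)$-bimodule $C={}_SC_R$ is semidualizing if: (a1) ${}_SC$ admits a degreewise finite $S$-projective resolution (a projective resolution by finitely generated projectives); (a2) $C_R$ admits a degreewise finite $R^{\mathrm{op}}$-projective resolution; (b1) the homothety map $S\to\operatorname{Hom}_{R^{\mathrm{op}}}(C,C)$, $s\mapsto(x\mapsto sx)$, is an isomorphism; (b2) the homothety map $R\to\operatorname{Hom}_S(C,C)$, $r\mapsto(x\mapsto xr)$, is an isomorphism; (c1) $\operatorname{Ext}_S^{i}(C,C)=0$ for all $i\geq1$; (c2) $\operatorname{Ext}_{R^{\mathrm{op}}}^{i}(C,C)=0$ for all $i\geq 1$. The Bass class $\mathcal{B}_C(S)$ consists of all $S$-modules $N$ with (B1) $\operatorname{Ext}_S^i(C,N)=0$ for all $i\ge1$; (B2) $\operatorname{Tor}_i^R(C,\operatorname{Hom}_S(C,N))=0$ for all $i\ge1$; (B3) the natural evaluation map $\nu_N\colon C\otimes_R\operatorname{Hom}_S(C,N)\to N$, $c\otimes f\mapsto f(c)$, is an isomorphism. An $S$-module is $C$-projective (respectively $C$-flat) if it has the form $C\otimes_RP$ (up to isomorphism) with $P$ a projective (respectively flat) $R$-module; $\mathcal{P}_C(S)$ is the class of $C$-projective $S$-modules. An augmented proper $C$-projective resolution of $N$ is a complex $W^+=\ \cdots\to W_1\to W_0\to N\to 0$ with all $W_i\in\mathcal{P}_C(S)$ such that $\operatorname{Hom}_S(V,W^+)$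 is exact for every $V\in\mathcal{P}_C(S)$ ($W^+$ itself is not required to be exact). An augmented injective coresolution of $N$ is an exact complex $0\to N\to I^0\to I^1\to\cdots$ with all $I^i$ injective. *)

(* Defs.v *)
From HB Require Import structures.
From mathcomp Require Import all_boot ssralg ssrint ring_quotient generic_quotient.
From mathcomp Require Import boolp.
From mathcomp.multinomials Require Import freeg.

Set Implicit Arguments.
Unset Strict Implicit.
Unset Printing Implicit Defensive.

Import GRing.Theory.
Local Open Scope ring_scope.
Local Open Scope quotient_scope.

(* Rings are arbitrary (the zero ring included), and modules are left modules.
   A right A-module is an [lmodType A^c], where A^c is the converse ring, so
   that [(a : A^c) *: x] is the element usually written xa. *)

Definition surjective (T U : Type) (f : T -> U) : Prop :=
  forall y, exists x, f x = y.

Definition exact_at (X Y : Type) (Z : nmodType) (f : X -> Y) (g : Y -> Z) : Prop :=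
  forall y, g y = 0 <-> exists x, f x = y.

Definition mklin (A : pzRingType) (U V : lmodType A) (f : U -> V)
  (f_lin : linear f) : {linear U -> V} :=
  HB.pack f (GRing.isLinear.Build A U V *:%R f f_lin).

Definition lmod_iso (A : pzRingType) (U V : lmodType A) : Prop :=
  exists f : {linear U -> V}, bijective f.

Section Kernel.
Variables (A : pzRingType) (U V : lmodType A) (f : {linear U -> V}).

Definition ker_pred : pred U := fun x => f x == 0.

Lemma ker_pred_submod : subsemimod_closed ker_pred.
Proof.
split; first split; rewrite /in_mem /= /ker_pred ?linear0 //.
  by move=> x y; rewrite /in_mem /= /ker_pred linearD => /eqP-> /eqP->; rewrite addr0.
by move=> a x; rewrite /in_mem /= /ker_pred linearZ => /eqP /= ->; rewrite scaler0.
Qed.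

HB.instance Definition _ :=
  GRing.isSubmodClosed.Build A U ker_pred ker_pred_submod.

Record ker : Type := Ker { ker_val :> U; _ : ker_pred ker_val }.

HB.instance Definition _ := [isSub for ker_val].
HB.instance Definition _ := [Choice of ker by <:].
HB.instance Definition _ := [SubChoice_isSubLmodule of ker by <:].

End Kernel.

Section HomGroup.
Variables (A : pzRingType) (U V : lmodType A).

Definition hom : Type := {linear U -> V}.

Implicit Types f g h : hom.

HB.instance Definition _ := gen_eqMixin hom.
HB.instance Definition _ := gen_choiceMixin hom.

Lemma hom_ext f g : f =1 g -> f = g.
Proof.
case: f g => [f [[fD] [fZ]]] [g [[gD] [gZ]]] /= /funext fg.
move: fD fZ; rewrite fg => fD fZ.
by rewrite (Prop_irrelevance fD gD) (Prop_irrelevance fZ gZ).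
Qed.

Definition hom_zero : hom := (\0 : U -> V).
Definition hom_opp f : hom := (\- (f : U -> V))%R.
Definition hom_add f g : hom := ((f : U -> V) \+ (g : U -> V)).

Lemma hom_addA : associative hom_add.
Proof. by move=> f g h; apply: hom_ext => x /=; rewrite addrA. Qed.
Lemma hom_addC : commutative hom_add.
Proof. by move=> f g; apply: hom_ext => x /=; rewrite addrC. Qed.
Lemma hom_add0 : left_id hom_zero hom_add.
Proof. by move=> f; apply: hom_ext => x /=; rewrite add0r. Qed.
Lemma hom_addN : left_inverse hom_zero hom_opp hom_add.
Proof. by move=> f; apply: hom_ext => x /=; rewrite addNr. Qed.

HB.instance Definition _ :=
  GRing.isZmodule.Build hom hom_addA hom_addC hom_add0 hom_addN.

End HomGroup.

Definition hom_post (A : pzRingType) (U V V' : lmodType A)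
  (g : {linear V -> V'}) (f : hom U V) : hom U V' := (g \o f).

Definition hom_pre (A : pzRingType) (U U' V : lmodType A)
  (g : {linear U' -> U}) (f : hom U V) : hom U' V := (f \o g).

Section Tensor.
Variables (A : pzRingType) (D : lmodType A^c) (M : lmodType A).

Local Notation F := {freeg (D * M)%type / int}.
Local Notation gen d m := (<< (d, m) >> : F).

Inductive tensor_rel : F -> Prop :=
| tensor_rel0 : tensor_rel 0
| tensor_relB x y : tensor_rel x -> tensor_rel y -> tensor_rel (x - y)
| tensor_relDl d d' m : tensor_rel (gen (d + d') m - (gen d m + gen d' m))
| tensor_relDr d m m' : tensor_rel (gen d (m + m') - (gen d m + gen d m'))
| tensor_relM (a : A) d m :
    tensor_rel (gen ((a : A^c) *: d) m - gen d (a *: m)).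

Definition tensor_relb (x : F) : bool := `[< tensor_rel x >].

Lemma tensor_relb_zmod : zmod_closed tensor_relb.
Proof.
split; first by apply/asboolP; constructor.
by move=> x y /asboolP xr /asboolP yr; apply/asboolP; constructor.
Qed.

HB.instance Definition _ := GRing.isZmodClosed.Build F tensor_relb tensor_relb_zmod.

Definition tensor_subgroup : zmodClosed F :=
  GRing.ZmodClosed.clone _ tensor_relb _.

Definition tensor : Type := Quotient.quot tensor_subgroup.

HB.instance Definition _ := GRing.Zmodule.on tensor.

Definition tpure (d : D) (m : M) : tensor :=
  \pi_(Quotient.quot tensor_subgroup) (gen d m).

Section Lift.
Variable V : zmodType.

Definition balanced (b : D -> M -> V) : Prop :=
  [/\ forall m, {morph b^~ m : d d' / d + d'},
      forall d, {morph b d : m m' / m + m'}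
    & forall (a : A) d m, b ((a : A^c) *: d) m = b d (a *: m)].

Definition tensor_lift (b : D -> M -> V) (x : tensor) : V :=
  fglift (fun dm => b dm.1 dm.2 : zmodule V) (repr x).

Section LiftTheory.
Variables (b : D -> M -> V) (b_bal : balanced b).

Let bz (dm : D * M) : zmodule V := b dm.1 dm.2.

Let bz_rel x : tensor_rel x -> fglift bz x = 0.
Proof.
case: b_bal => bDl bDr bM.
have liftB := @lift_is_additive _ _ _ bz.
have lift0 : fglift bz 0 = 0 by rewrite -(subrr 0) liftB subrr.
have liftD x' y' : fglift bz (x' + y') = fglift bz x' + fglift bz y'.
  by rewrite -{1}[y']opprK liftB -(sub0r y') liftB lift0 sub0r opprK.
elim=> [//|{}x y _ x0 _ y0|d d' m|d m m'|a d m].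
- by rewrite liftB x0 y0 subrr.
- by rewrite liftB liftD !liftU !scale1r /bz /= bDl subrr.
- by rewrite liftB liftD !liftU !scale1r /bz /= bDr subrr.
- by rewrite liftB !liftU !scale1r /bz /= bM subrr.
Qed.

Let tensor_lift_pi x :
  tensor_lift b (\pi_(Quotient.quot tensor_subgroup) x) = fglift bz x.
Proof.
rewrite /tensor_lift -/bz; apply/eqP; rewrite -subr_eq0.
rewrite -(@lift_is_additive _ _ _ bz); apply/eqP/bz_rel.
have /asboolP// : repr (\pi_(Quotient.quot tensor_subgroup) x) - x \in tensor_subgroup.
by rewrite Quotient.idealrBE reprK.
Qed.

Lemma tensor_lift_pure d m : tensor_lift b (tpure d m) = b d m.
Proof. by rewrite tensor_lift_pi liftU scale1r. Qed.

Lemma tensor_lift_additive : zmod_morphism (tensor_lift b).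
Proof.
move=> x y; rewrite -[x]reprK -[y]reprK -raddfB !tensor_lift_pi.
rewrite (@lift_is_additive _ _ _ bz); reflexivity.
Qed.

End LiftTheory.
End Lift.

Lemma tensor_pi_eq x y :
  tensor_rel (x - y) -> \pi_tensor x = \pi_tensor y :> tensor.
Proof.
by move=> xy; apply/eqP; rewrite -Quotient.idealrBE; apply/asboolP.
Qed.

Lemma tpureDl m : {morph tpure^~ m : d d' / d + d'}.
Proof.
move=> d d'; rewrite /tpure -raddfD; apply: tensor_pi_eq.
exact: tensor_relDl.
Qed.

Lemma tpureDr d : {morph tpure d : m m' / m + m'}.
Proof.
move=> m m'; rewrite /tpure -raddfD; apply: tensor_pi_eq.
exact: tensor_relDr.
Qed.

Lemma tpureM (a : A) d m : tpure ((a : A^c) *: d) m = tpure d (a *: m).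
Proof. by apply: tensor_pi_eq; apply: tensor_relM. Qed.

Lemma tpure_balanced : balanced tpure.
Proof. by split; [apply: tpureDl | apply: tpureDr | apply: tpureM]. Qed.

Lemma tensor_ind (P : tensor -> Prop) :
  P 0 -> (forall x y, P x -> P y -> P (x - y)) -> (forall d m, P (tpure d m)) ->
  forall x, P x.
Proof.
move=> P0 PB Pp.
have PN x : P x -> P (- x) by move=> Px; rewrite -sub0r; apply: PB.
have PD x y : P x -> P y -> P (x + y).
  by move=> Px Py; rewrite -[y]opprK; apply: PB => //; apply: PN.
have PM x n : P x -> P (x *+ n).
  by move=> Px; elim: n => [|n IH]; rewrite ?mulr0n // mulrS; apply: PD.
have Pz x (k : int) : P x -> P (x *~ k).
  by case: k => n Px; rewrite ?NegzE ?mulrNz -pmulrn; [apply: PM|apply/PN/PM].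
move=> x; rewrite -[x]reprK -[repr x]freeg_sumE raddf_sum.
elim/big_ind: _ => // [[d m] _].
have -> : (<< coeff (d, m) (repr x) *g (d, m) >> : F) =
          gen d m *~ coeff (d, m) (repr x).
  by rewrite freegU_mulz intz.
by rewrite raddfMz; apply/Pz/Pp.
Qed.

End Tensor.

Arguments tpure {A D M} d m.

Section TensorMap.
Variables (A : pzRingType) (D D' : lmodType A^c) (M M' : lmodType A).
Variables (f : {linear D -> D'}) (g : {linear M -> M'}).

Definition tensor_map : tensor D M -> tensor D' M' :=
  tensor_lift (fun d m => tpure (f d) (g m)).

Lemma tensor_map_balanced : balanced (fun d m => tpure (f d) (g m)).
Proof.
split=> [m d d'|d m m'|a d m]; rewrite ?linearD ?tpureDl ?tpureDr //.
by rewrite !linearZ tpureM.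
Qed.

Lemma tensor_map_pure d m : tensor_map (tpure d m) = tpure (f d) (g m).
Proof. exact: (tensor_lift_pure tensor_map_balanced). Qed.

Lemma tensor_map_additive : zmod_morphism tensor_map.
Proof. exact: (tensor_lift_additive tensor_map_balanced). Qed.

HB.instance Definition _ :=
  GRing.isZmodMorphism.Build (tensor D M) (tensor D' M') tensor_map
    tensor_map_additive.

End TensorMap.

Section ModuleClasses.
Variable A : pzRingType.

Definition projective (P : lmodType A) : Prop :=
  forall (X Y : lmodType A) (p : {linear X -> Y}) (f : {linear P -> Y}),
    surjective p -> exists h : {linear P -> X}, forall x, p (h x) = f x.

Definition injective_module (I : lmodType A) : Prop :=
  forall (X Y : lmodType A) (i : {linear X -> Y}) (f : {linear X -> I}),
    injective i -> exists h : {linear Y -> I}, forall x, h (i x) = f x.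

Definition flat (F : lmodType A) : Prop :=
  forall (X Y Z : lmodType A^c) (f : {linear X -> Y}) (g : {linear Y -> Z}),
    exact_at f g ->
    exact_at (tensor_map f (idfun : {linear F -> F}))
             (tensor_map g (idfun : {linear F -> F})).

Definition finitely_generated (M : lmodType A) : Prop :=
  exists (n : nat) (e : 'I_n -> M),
    forall x, exists c : 'I_n -> A, x = \sum_(i < n) c i *: e i.

End ModuleClasses.

(* ... -> X_1 -> X_0 -> M -> 0 *)
Record aug_chain (A : pzRingType) (M : lmodType A) := AugChain {
  ac_ob :> nat -> lmodType A;
  ac_d : forall n, {linear ac_ob n.+1 -> ac_ob n};
  ac_eps : {linear ac_ob 0 -> M};
  ac_dd : forall n x, ac_d n (ac_d n.+1 x) = 0;
  ac_epsd : forall x, ac_eps (ac_d 0 x) = 0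
}.

(* 0 -> M -> X^0 -> X^1 -> ... *)
Record aug_cochain (A : pzRingType) (M : lmodType A) := AugCochain {
  cc_ob :> nat -> lmodType A;
  cc_d : forall n, {linear cc_ob n -> cc_ob n.+1};
  cc_eta : {linear M -> cc_ob 0};
  cc_dd : forall n x, cc_d n.+1 (cc_d n x) = 0;
  cc_deta : forall x, cc_d 0 (cc_eta x) = 0
}.

Section Resolutions.
Variables (A : pzRingType) (M : lmodType A).

Definition aug_chain_exact (X : aug_chain M) : Prop :=
  [/\ surjective (ac_eps X),
      exact_at (ac_d X 0) (ac_eps X)
    & forall n, exact_at (ac_d X n.+1) (ac_d X n)].

Definition aug_cochain_exact (X : aug_cochain M) : Prop :=
  [/\ injective (cc_eta X),
      exact_at (cc_eta X) (cc_d X 0)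
    & forall n, exact_at (cc_d X n) (cc_d X n.+1)].

Definition projective_resolution (P : aug_chain M) : Prop :=
  (forall n, projective (P n)) /\ aug_chain_exact P.

Definition degreewise_finite_resolution (P : aug_chain M) : Prop :=
  projective_resolution P /\ forall n, finitely_generated (P n).

Definition injective_coresolution (I : aug_cochain M) : Prop :=
  (forall n, injective_module (I n)) /\ aug_cochain_exact I.

Definition hom_aug_chain_exact (V : lmodType A) (X : aug_chain M) : Prop :=
  [/\ surjective (@hom_post A V _ _ (ac_eps X)),
      exact_at (@hom_post A V _ _ (ac_d X 0)) (@hom_post A V _ _ (ac_eps X))
    & forall n,
      exact_at (@hom_post A V _ _ (ac_d X n.+1)) (@hom_post A V _ _ (ac_d X n))].

End Resolutions.

(* Ext^i_A(M, N) = 0 and Tor_i^A(D, M) = 0: the i-th (co)homology of Hom(P, N),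
   resp. of D (x) P, vanishes, P being any projective resolution of M. One always
   exists: see free_resolution_projective below. *)
Definition Ext_eq0 (A : pzRingType) (i : nat) (M N : lmodType A) : Prop :=
  forall P : aug_chain M, projective_resolution P ->
    match i with
    | 0 => forall f : hom (P 0) N, hom_pre (ac_d P 0) f = 0 -> f = 0
    | n.+1 => exact_at (@hom_pre A _ _ N (ac_d P n)) (@hom_pre A _ _ N (ac_d P n.+1))
    end.

Definition Tor_eq0 (A : pzRingType) (i : nat) (D : lmodType A^c) (M : lmodType A) :
    Prop :=
  forall P : aug_chain M, projective_resolution P ->
    match i with
    | 0 => surjective (tensor_map (idfun : {linear D -> D}) (ac_d P 0))
    | n.+1 => exact_at (tensor_map (idfun : {linear D -> D}) (ac_d P n.+1))
                       (tensor_map (idfun : {linear D -> D}) (ac_d P n))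
    end.

HB.mixin Record isBimodule (S R : pzRingType) C of GRing.Lmodule S C := {
  ract : C -> R -> C;
  ractA : forall x a b, ract (ract x a) b = ract x (a * b);
  ract1 : forall x, ract x 1 = x;
  ractDl : forall a, {morph ract^~ a : x y / x + y};
  ractDr : forall x, {morph ract x : a b / a + b};
  ractZ : forall (s : S) x a, ract (s *: x) a = s *: ract x a
}.

#[short(type="bimodType")]
HB.structure Definition Bimodule (S R : pzRingType) :=
  {C of isBimodule S R C & GRing.Lmodule S C}.

Section BimoduleTheory.
Variables (S R : pzRingType) (C : bimodType S R).

(* The underlying right R-module of C. *)
Definition rmod : Type := C.

HB.instance Definition _ := GRing.Zmodule.on rmod.

Definition rmod_scale (a : R^c) (x : rmod) : rmod := ract (x : C) a.

Lemma rmod_scaleA a b x : rmod_scale a (rmod_scale b x) = rmod_scale (a * b) x.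
Proof. exact: ractA. Qed.
Lemma rmod_scale1 : left_id 1 rmod_scale.
Proof. exact: ract1. Qed.
Lemma rmod_scaleDr : right_distributive rmod_scale +%R.
Proof. by move=> a x y; apply: ractDl. Qed.
Lemma rmod_scaleDl x : {morph rmod_scale^~ x : a b / a + b}.
Proof. by move=> a b; apply: ractDr. Qed.

HB.instance Definition _ := GRing.Zmodule_isLmodule.Build R^c rmod
  rmod_scaleA rmod_scale1 rmod_scaleDr rmod_scaleDl.

Lemma lmul_linear (s : S) : linear (fun x : rmod => (s *: (x : C)) : rmod).
Proof.
move=> a x y; rewrite [LHS]scalerDr; congr (_ + _).
exact/esym/(ractZ s (x : C)).
Qed.

Lemma rmul_linear (a : R) : linear (fun x : C => ract x a).
Proof. by move=> s x y; rewrite ractDl ractZ. Qed.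

Definition left_homothety (s : S) : hom rmod rmod := mklin (lmul_linear s).
Definition right_homothety (a : R) : hom C C := mklin (rmul_linear a).

(* Hom_S(C, N), with the left R-action (a f)(x) = f (x a). *)
Section BHom.
Variable N : lmodType S.

Definition bhom : Type := hom C N.

HB.instance Definition _ := GRing.Zmodule.on bhom.

Definition bhom_scale (a : R) (f : bhom) : bhom := hom_pre (right_homothety a) f.

Lemma bhom_scaleA a b f : bhom_scale a (bhom_scale b f) = bhom_scale (a * b) f.
Proof. by apply: hom_ext => x /=; rewrite ractA. Qed.
Lemma bhom_scale1 : left_id 1 bhom_scale.
Proof. by move=> f; apply: hom_ext => x /=; rewrite ract1. Qed.
Lemma bhom_scaleDr : right_distributive bhom_scale +%R.
Proof. by move=> a f g; apply: hom_ext. Qed.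
Lemma bhom_scaleDl f : {morph bhom_scale^~ f : a b / a + b}.
Proof. by move=> a b; apply: hom_ext => x /=; rewrite ractDr linearD. Qed.

HB.instance Definition _ := GRing.Zmodule_isLmodule.Build R bhom
  bhom_scaleA bhom_scale1 bhom_scaleDr bhom_scaleDl.

End BHom.

Lemma bhom_map_linear (N N' : lmodType S) (g : {linear N -> N'}) :
  linear (fun f : bhom N => hom_post g f : bhom N').
Proof. by move=> a f h; apply: hom_ext => x /=; rewrite linearD. Qed.

Definition bhom_map (N N' : lmodType S) (g : {linear N -> N'}) :
  {linear bhom N -> bhom N'} := mklin (bhom_map_linear g).

(* C (x)_R M, with the left S-action s (c (x) m) = (s c) (x) m. *)
Section BTensor.
Variable M : lmodType R.

Definition btensor : Type := tensor rmod M.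

HB.instance Definition _ := GRing.Zmodule.on btensor.

Definition btensor_scale (s : S) : btensor -> btensor :=
  tensor_map (left_homothety s) (idfun : {linear M -> M}).

Let scaleB s : zmod_morphism (btensor_scale s).
Proof. exact: tensor_map_additive. Qed.
Let scale0 s : btensor_scale s 0 = 0.
Proof. by rewrite -[0 in LHS](subrr 0) scaleB subrr. Qed.

Lemma btensor_scale_pure s (c : rmod) (m : M) :
  btensor_scale s (tpure c m) = tpure (left_homothety s c) m.
Proof. exact: tensor_map_pure. Qed.

Lemma btensor_ind (P : btensor -> Prop) :
  P 0 -> (forall x y, P x -> P y -> P (x - y)) ->
  (forall (c : rmod) (m : M), P (tpure c m)) -> forall x, P x.
Proof. exact: tensor_ind. Qed.

Lemma btensor_scaleA s t x :
  btensor_scale s (btensor_scale t x) = btensor_scale (s * t) x.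
Proof.
elim/btensor_ind: x => [|x y Hx Hy|c m]; rewrite ?scale0 ?scaleB ?Hx ?Hy //.
by rewrite !btensor_scale_pure /= scalerA.
Qed.
Lemma btensor_scale1 : left_id 1 btensor_scale.
Proof.
elim/btensor_ind => [|x y Hx Hy|c m]; rewrite ?scale0 ?scaleB ?Hx ?Hy //.
by rewrite btensor_scale_pure /= scale1r.
Qed.
Lemma btensor_scaleDr : right_distributive btensor_scale +%R.
Proof. by move=> s x y; apply: raddfD. Qed.
Lemma btensor_scaleDl x : {morph btensor_scale^~ x : s t / s + t}.
Proof.
move=> s t; elim/btensor_ind: x => [|x y Hx Hy|c m].
- by rewrite !scale0 addr0.
- by rewrite !scaleB Hx Hy opprD addrACA.
- rewrite !btensor_scale_pure -tpureDl; congr (tpure _ m); exact: (scalerDl (c : C)).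
Qed.

HB.instance Definition _ := GRing.Zmodule_isLmodule.Build S btensor
  btensor_scaleA btensor_scale1 btensor_scaleDr btensor_scaleDl.

End BTensor.

(* The evaluation map c (x) f |-> f c. *)
Section Evaluation.
Variable N : lmodType S.

Definition evaluation (x : btensor (bhom N)) : N :=
  tensor_lift (fun (c : rmod) (f : bhom N) => (f : {linear C -> N}) c) x.

Lemma evaluation_balanced :
  balanced (fun (c : rmod) (f : bhom N) => (f : {linear C -> N}) c).
Proof. by split=> // f c c'; apply: linearD. Qed.

Lemma evaluation_pure (c : rmod) (f : bhom N) :
  evaluation (tpure c f) = (f : {linear C -> N}) c.
Proof. exact: (tensor_lift_pure evaluation_balanced). Qed.

Lemma evaluation_linear : linear evaluation.
Proof.
have evB : zmod_morphism evaluation := tensor_lift_additive evaluation_balanced.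
have ev0 : evaluation 0 = 0 by rewrite -[0 in LHS](subrr 0) evB subrr.
have evD x y : evaluation (x + y) = evaluation x + evaluation y.
  by rewrite -{1}[y]opprK evB -(sub0r y) evB ev0 sub0r opprK.
move=> s x y; rewrite evD; congr (_ + _).
elim/btensor_ind: x => [|x z Hx Hz|c f]; first by rewrite scaler0 !ev0 scaler0.
  by rewrite scalerBr !evB Hx Hz scalerBr.
rewrite [s *: _]btensor_scale_pure !evaluation_pure; exact: linearZ.
Qed.

HB.instance Definition _ :=
  GRing.isLinear.Build S (btensor (bhom N)) N *:%R evaluation evaluation_linear.

End Evaluation.

Record semidualizing : Prop := Semidualizing {
  semidualizing_resolution : exists P : aug_chain (C : lmodType S),
    degreewise_finite_resolution P;
  semidualizing_resolution_op : exists P : aug_chain (rmod : lmodType R^c),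
    degreewise_finite_resolution P;
  left_homothety_bij : bijective left_homothety;
  right_homothety_bij : bijective right_homothety;
  semidualizing_Ext : forall i, (1 <= i)%N -> Ext_eq0 i (C : lmodType S) C;
  semidualizing_Ext_op : forall i, (1 <= i)%N -> Ext_eq0 i (rmod : lmodType R^c) rmod
}.

Record Bass_class (N : lmodType S) : Prop := BassClass {
  Bass_Ext : forall i, (1 <= i)%N -> Ext_eq0 i (C : lmodType S) N;
  Bass_Tor : forall i, (1 <= i)%N -> Tor_eq0 i rmod (bhom N);
  Bass_evaluation : bijective (@evaluation N)
}.

Definition C_projective (W : lmodType S) : Prop :=
  exists2 P : lmodType R, projective P & lmod_iso W (btensor P).

Definition C_flat (W : lmodType S) : Prop :=
  exists2 F : lmodType R, flat F & lmod_iso W (btensor F).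

Definition proper_C_projective_resolution (N : lmodType S) (W : aug_chain N) :
    Prop :=
  (forall n, C_projective (W n)) /\
  forall V, C_projective V -> hom_aug_chain_exact V W.

End BimoduleTheory.

Record two_sided (A : pzRingType) := TwoSided {
  ts_W : nat -> lmodType A;
  ts_I : nat -> lmodType A;
  ts_dW : forall n, {linear ts_W n.+1 -> ts_W n};
  ts_dI : forall n, {linear ts_I n -> ts_I n.+1};
  ts_d : {linear ts_W 0 -> ts_I 0};
  ts_dWdW : forall n x, ts_dW n (ts_dW n.+1 x) = 0;
  ts_ddW : forall x, ts_d (ts_dW 0 x) = 0;
  ts_dId : forall x, ts_dI 0 (ts_d x) = 0;
  ts_dIdI : forall n x, ts_dI n.+1 (ts_dI n x) = 0
}.

Definition two_sided_exact (A : pzRingType) (Y : two_sided A) : Prop :=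
  [/\ forall n, exact_at (ts_dW Y n.+1) (ts_dW Y n),
      exact_at (ts_dW Y 0) (ts_d Y),
      exact_at (ts_d Y) (ts_dI Y 0)
    & forall n, exact_at (ts_dI Y n) (ts_dI Y n.+1)].

Section HomComplex.
Variables (S R : pzRingType) (C : bimodType S R) (Y : two_sided S).

Lemma bhom_map_comp0 (X1 X2 X3 : lmodType S) (f : {linear X1 -> X2})
    (g : {linear X2 -> X3}) (gf0 : forall x, g (f x) = 0) (u : bhom C X1) :
  bhom_map C g (bhom_map C f u) = 0.
Proof. by apply: hom_ext => x /=; rewrite gf0. Qed.

Definition bhom_two_sided : two_sided R :=
  @TwoSided R (fun n => bhom C (ts_W Y n)) (fun n => bhom C (ts_I Y n))
    (fun n => bhom_map C (ts_dW Y n)) (fun n => bhom_map C (ts_dI Y n))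
    (bhom_map C (ts_d Y))
    (fun n => bhom_map_comp0 (@ts_dWdW S Y n)) (bhom_map_comp0 (@ts_ddW S Y))
    (bhom_map_comp0 (@ts_dId S Y)) (fun n => bhom_map_comp0 (@ts_dIdI S Y n)).

End HomComplex.

Section Splice.
Variables (A : pzRingType) (N : lmodType A).
Variables (W : aug_chain N) (I : aug_cochain N).

Definition splice_d : {linear W 0 -> I 0} := cc_eta I \o ac_eps W.

Lemma splice_ddW x : splice_d (ac_d W 0 x) = 0.
Proof. by rewrite /= ac_epsd linear0. Qed.

Lemma splice_dId x : cc_d I 0 (splice_d x) = 0.
Proof. by rewrite /= cc_deta. Qed.

Definition splice : two_sided A :=
  @TwoSided A W I (ac_d W) (cc_d I) splice_d
    (@ac_dd A N W) splice_ddW splice_dId (@cc_dd A N I).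

End Splice.

(* CW is the class to which the W_n must belong: C-projectives or C-flats. *)
Record Bass_complex (S R : pzRingType) (C : bimodType S R)
    (CW : lmodType S -> Prop) (N : lmodType S) (Y : two_sided S) : Prop := {
  Bass_complex_exact : two_sided_exact Y;
  Bass_complex_inj : forall n, injective_module (ts_I Y n);
  Bass_complex_class : forall n, CW (ts_W Y n);
  Bass_complex_ker : lmod_iso N (ker (ts_dI Y 0));
  Bass_complex_hom_exact : two_sided_exact (bhom_two_sided C Y)
}.

(* The free module on X is A (x)_Z Z^(X): [{freeg X / A}] would require A to be
   nonzero. *)
Section FreeModule.
Variable A : pzRingType.

Definition regular_bimod : Type := A.

HB.instance Definition _ := GRing.Lmodule.copy regular_bimod A^o.

Definition regular_ract (x : regular_bimod) (k : int) : regular_bimod := x *~ k.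

Lemma regular_ractA x a b :
  regular_ract (regular_ract x a) b = regular_ract x (a * b).
Proof. by rewrite /regular_ract mulrzA. Qed.
Lemma regular_ractDl a : {morph regular_ract^~ a : x y / x + y}.
Proof. by move=> x y; apply: mulrzDl. Qed.
Lemma regular_ractDr x : {morph regular_ract x : a b / a + b}.
Proof. by move=> a b; apply: mulrzDr. Qed.
Lemma regular_ractZ (s : A) x a :
  regular_ract (s *: x) a = s *: regular_ract x a.
Proof. by rewrite /regular_ract -scalerMzr. Qed.

HB.instance Definition _ := isBimodule.Build A int regular_bimod
  regular_ractA (@mulr1z regular_bimod) regular_ractDl regular_ractDr regular_ractZ.

Variable X : choiceType.

Definition free_module : lmodType A := btensor regular_bimod {freeg X / int}.

Definition free_gen (x : X) : free_module :=
  tpure (1 : rmod regular_bimod) (<< x >> : {freeg X / int}).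

Section Lift.
Variables (V : lmodType A) (g : X -> V).

Let gz (m : {freeg X / int}) : V := fglift (g : X -> zmodule V) m.

Let b (a : rmod regular_bimod) (m : {freeg X / int}) : V := (a : A) *: gz m.

Let gzB : zmod_morphism gz := @lift_is_additive _ _ (zmodule V) g.

Let b_balanced : balanced b.
Proof.
pose gz' := HB.pack_for {additive {freeg X / int} -> V} gz
  (GRing.isZmodMorphism.Build _ _ gz gzB).
have gzD x y : gz (x + y) = gz x + gz y := raddfD gz' x y.
have gzMz x k : gz (x *~ k) = gz x *~ k := raddfMz gz' k x.
split => [m a a'|a m m'|k a m]; first exact: scalerDl.
  by rewrite /b gzD scalerDr.
have -> : k *: m = m *~ k.
  apply/eqP/freeg_eqP => x; rewrite coeffZ raddfMz /= -mulrzr intz; exact: mulrC.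
by rewrite /b gzMz -scalerMzr scalerMzl.
Qed.

Definition free_lift_fun : free_module -> V := tensor_lift b.

Lemma free_lift_linear : linear free_lift_fun.
Proof.
have fB : zmod_morphism free_lift_fun := tensor_lift_additive b_balanced.
have f0 : free_lift_fun 0 = 0 by rewrite -[0 in LHS](subrr 0) fB subrr.
have fD x y : free_lift_fun (x + y) = free_lift_fun x + free_lift_fun y.
  by rewrite -{1}[y]opprK fB -(sub0r y) fB f0 sub0r opprK.
have fp a m : free_lift_fun (tpure a m) = b a m := tensor_lift_pure b_balanced a m.
move=> s x y; rewrite fD; congr (_ + _).
elim/btensor_ind: x => [|x z Hx Hz|c f]; first by rewrite scaler0 !f0 scaler0.
  by rewrite scalerBr !fB Hx Hz scalerBr.
by rewrite [s *: _]btensor_scale_pure !fp /b /= scalerA.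
Qed.

Definition free_lift : {linear free_module -> V} := mklin free_lift_linear.

Lemma free_lift_gen x : free_lift (free_gen x) = g x.
Proof.
by rewrite /= /free_lift_fun tensor_lift_pure // /b /gz liftU !scale1r.
Qed.

End Lift.

Lemma free_hom_ext (V : lmodType A) (f h : {linear free_module -> V}) :
  (forall x, f (free_gen x) = h (free_gen x)) -> f =1 h.
Proof.
move=> fh; elim/btensor_ind => [|x y Hx Hy|a m]; first by rewrite !linear0.
  by rewrite !linearB Hx Hy.
have -> : tpure a m = (a : A) *: (tpure (1 : rmod regular_bimod) m : free_module).
  by rewrite [RHS]btensor_scale_pure /=; congr tpure; rewrite [RHS]mulr1.
rewrite !linearZ /=; congr (_ *: _).
rewrite -[m]freeg_sumE.
elim/big_rec: _ => [|x n _ IH].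
  have -> : tpure (1 : rmod regular_bimod) (0 : {freeg X / int}) = (0 : free_module).
    set t : free_module := tpure _ _.
    have t2 : t = t + t by rewrite -[RHS]tpureDr addr0.
    by rewrite -[LHS](addrK t) -t2 subrr.
  by rewrite !linear0.
rewrite tpureDr [f _]linearD [h _]linearD IH; congr (_ + _).
set k := coeff x m.
have -> : (<< k *g x >> : {freeg X / int}) = k *: << x >>.
  by apply/eqP/freeg_eqP => y; rewrite coeffZ !coeffU mulrA mulr1.
rewrite -tpureM.
have -> : tpure ((k : int^c) *: (1 : rmod regular_bimod)) (<< x >> : {freeg X / int})
    = (1 *~ k : A) *: free_gen x.
  by rewrite [RHS]btensor_scale_pure; congr tpure; rewrite /= [RHS]mulr1.
by rewrite !linearZ /= fh.
Qed.

Lemma free_module_projective : projective free_module.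
Proof.
move=> U V p f p_surj.
have [g pg] : {g : X -> U & forall x, p (g x) = f (free_gen x)}.
  exists (fun x => projT1 (cid (p_surj (f (free_gen x))))) => x.
  by case: cid.
exists (free_lift g) => x.
have := @free_hom_ext V (p \o free_lift g) f; apply => y.
exact: (etrans (congr1 p (free_lift_gen g y)) (pg y)).
Qed.

End FreeModule.

Section ProjectiveResolution.
Variables (A : pzRingType) (M : lmodType A).

Definition cover (N : lmodType A) : {linear free_module A N -> N} :=
  free_lift (fun x : N => x).

Lemma cover_surjective N : surjective (cover N).
Proof. by move=> x; exists (free_gen A x); apply: free_lift_gen. Qed.

Fixpoint syzygy (n : nat) : lmodType A :=
  if n is n'.+1 then ker (cover (syzygy n')) else M.

Lemma ker_val_linear (U V : lmodType A) (f : {linear U -> V}) :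
  linear (@ker_val A U V f).
Proof. by []. Qed.

Definition ker_incl (U V : lmodType A) (f : {linear U -> V}) : {linear ker f -> U} :=
  mklin (@ker_val_linear U V f).

Lemma ker_valP (U V : lmodType A) (f : {linear U -> V}) (x : ker f) :
  f (ker_val x) = 0.
Proof. by apply/eqP; case: x. Qed.

Definition free_resolution_d n :
    {linear free_module A (syzygy n.+1) -> free_module A (syzygy n)} :=
  ker_incl (cover (syzygy n)) \o cover (syzygy n.+1).

Lemma free_resolution_epsd n x : cover (syzygy n) (free_resolution_d n x) = 0.
Proof. exact: (ker_valP (cover (syzygy n.+1) x : ker (cover (syzygy n)))). Qed.

Lemma free_resolution_dd n x :
  free_resolution_d n (free_resolution_d n.+1 x) = 0.
Proof.
by rewrite [LHS](congr1 (ker_incl _) (@free_resolution_epsd n.+1 x)) linear0.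
Qed.

Definition free_resolution : aug_chain M :=
  @AugChain A M (fun n => free_module A (syzygy n)) free_resolution_d
    (cover M) free_resolution_dd (@free_resolution_epsd 0).

Lemma free_resolution_projective : projective_resolution free_resolution.
Proof.
have ex n : exact_at (free_resolution_d n) (cover (syzygy n)).
  move=> y; split=> [y0|[x <-]]; last exact: free_resolution_epsd.
  have yk : ker_pred (cover (syzygy n)) y by apply/eqP.
  have [x xy] := cover_surjective (Ker yk : syzygy n.+1).
  by exists x; apply: (congr1 (@ker_val _ _ _ (cover (syzygy n))) xy).
split=> [n|]; first exact: free_module_projective.
split; [exact: cover_surjective | exact: ex | move=> n y].
rewrite -(ex n.+1); split=> y0; first exact: (@val_inj _ _ (ker (cover (syzygy n)))).
by rewrite [LHS](congr1 (ker_incl _) y0) linear0.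
Qed.

End ProjectiveResolution.

(* Main.v *)
(* Two facts carry the argument.  First, the unit F -> Hom_S(C, C (x) F) is
   bijective for every flat F: Hom_S(P, C) (x) F -> Hom_S(P, C (x) F) is bijective
   for P finitely generated projective, hence for the finitely presented module C,
   and Hom_S(C, C) = R.  So Hom_S(C, -) turns C-flat modules into flat ones, and
   the evaluation map of a C-flat module is bijective.  Second, balancing of Ext
   and Tor: Ext^i(C, N) = 0 for all i >= 1 iff Hom(C, -) keeps an injective
   coresolution of N exact in positive degrees, and Tor_i(C, M) can be tested on
   any flat resolution of M.

   Given N in the Bass class, Hom_S(C, W+) is a projective resolution of
   Hom_S(C, N), and tensoring it with C gives back W+, which is therefore exact.
   Conversely, Hom_S(C, -) of the left half of Y is a flat resolution of
   Hom_S(C, N) whose tensor product with C is that left half, which gives the Tor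
   vanishing and the bijectivity of evaluation; the right half gives the Ext
   vanishing.  Injective coresolutions are built from Hom_Z(S, (Q/Z)^X). *)
From HB Require Import structures.
Require Import Defs.
From mathcomp Require Import all_boot order ssralg ssrnum ssrint rat intdiv archimedean.
From mathcomp Require Import ring_quotient generic_quotient.
From mathcomp Require Import boolp classical_sets functions.
From mathcomp.multinomials Require Import freeg.
Import Defs.

Set Implicit Arguments.
Unset Strict Implicit.
Unset Printing Implicit Defensive.

Import Order.TTheory GRing.Theory Num.Theory.
Local Open Scope ring_scope.
Local Open Scope quotient_scope.

Lemma exact_at_comp0 (X Y : Type) (Z : nmodType) (f : X -> Y) (g : Y -> Z) x :
  exact_at f g -> g (f x) = 0.
Proof. by move=> fg; apply/fg; exists x. Qed.

(** * Characters with values in Q/Z *)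

Section AdditiveExtension.
Variables (Y D : zmodType).
Hypothesis D_divisible : forall n (d : D), (0 < n)%N -> exists d', d' *+ n = d.
Local Open Scope classical_set_scope.

(** Graphs of additive maps from a subgroup of [Y] to [D]. Given closure under subtraction,
    single-valuedness need only be asked at 0. Extending a map becomes enlarging a set, the form in
    which Zorn's lemma applies. *)
Definition partial_additive (G : set (Y * D)) : Prop :=
  [/\ G 0, forall u v, G u -> G v -> G (u - v) & forall d, G (0, d) -> d = 0].

Section Closure.
Variables (G : set (Y * D)) (hG : partial_additive G).

Lemma partial_additiveN u : G u -> G (- u).
Proof. by case: hG => G0 GB _ Gu; rewrite -sub0r; apply: GB. Qed.

Lemma partial_additiveD u v : G u -> G v -> G (u + v).
Proof.
by case: hG => _ GB _ Gu /partial_additiveN Gv; rewrite -[v]opprK; apply: GB.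
Qed.

Lemma partial_additiveMn u n : G u -> G (u *+ n).
Proof.
move=> Gu; elim: n => [|n IH]; first by case: hG.
by rewrite mulrS; apply: partial_additiveD.
Qed.

Lemma partial_additiveMz u (k : int) : G u -> G (u *~ k).
Proof.
move=> Gu; case: k => n; rewrite ?NegzE ?mulrNz -pmulrn.
  exact: partial_additiveMn.
exact/partial_additiveN/partial_additiveMn.
Qed.

Lemma partial_additive_fun y d d' : G (y, d) -> G (y, d') -> d = d'.
Proof.
case: hG => _ GB G1 Gd Gd'; apply/eqP; rewrite -subr_eq0; apply/eqP/G1.
by have := GB _ _ Gd Gd'; rewrite (_ : (y, d) - (y, d') = (y - y, d - d')) // subrr.
Qed.

End Closure.

Lemma pair_mulrz (y : Y) (d : D) (k : int) : (y, d) *~ k = (y *~ k, d *~ k).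
Proof.
have N n : (y, d) *+ n = (y *+ n, d *+ n).
  by elim: n => [|n IH]; rewrite ?mulr0n // !mulrS IH.
by case: k => n; rewrite ?NegzE ?mulrNz -!pmulrn N.
Qed.

(* The multiples of y lying in the domain of G form an ideal of Z; the value
   at y is obtained by dividing the value at its generator. *)
Lemma partial_additive_step (G : set (Y * D)) y :
  partial_additive G ->
  exists d, forall (k : int) e, G (y *~ k, e) -> e = d *~ k.
Proof.
move=> hG; pose p n := `[< (0 < n)%N /\ exists e, G (y *+ n, e) >].
have abs (k : int) e : k != 0 -> G (y *~ k, e) -> p `|k|%N.
  move=> k0 Gk; apply/asboolP; split; first by rewrite absz_gt0.
  case: k k0 Gk => n k0 Gk; first by exists e; rewrite pmulrn.
  exists (- e); rewrite NegzE in Gk *; rewrite abszN pmulrn.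
  by have := partial_additiveN hG Gk; rewrite mulrNz /= -[- _]/(- - _, - e) opprK.
have [ep|np] := pselect (exists n, p n); last first.
  (* No nonzero multiple of [y] lies in the domain of [G], so any value would do. *)
  exists 0 => k e Gk.
  have [k0|/abs/(_ Gk) pk] := eqVneq k 0; last by case: np; exists `|k|%N.
  by case: hG Gk => _ _ G1; rewrite k0 !mulr0z => /G1.
case: (ex_minnP ep) => n /asboolP[n0 [d0 Gd0]] minn.
have [d dn] := D_divisible d0 n0; exists d => k e Gk.
have Gn j : G (y *~ (j * n%:Z), d0 *~ j).
  by rewrite mulrC mulrzA -pmulrn -pair_mulrz; apply: partial_additiveMz.
have Gr : G (y *~ (k %% n)%Z, e - d0 *~ (k %/ n)%Z).
  have [_ GB _] := hG; have := GB _ _ Gk (Gn (k %/ n)%Z).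
  by rewrite /modz mulrzBr.
have r0 : (k %% n)%Z = 0.
  apply/eqP; apply: contraT => /abs/(_ Gr)/minn.
  by rewrite leqNgt -ltz_nat gez0_abs ?modz_ge0 ?ltz_pmod // gt_eqF.
rewrite r0 mulr0z in Gr; case: hG => _ _ /(_ _ Gr)/eqP.
rewrite subr_eq0 => /eqP->.
by rewrite [in RHS](divz_eq k n) r0 addr0 mulrC mulrzA -pmulrn dn.
Qed.

(** Divisible groups are injective: Zorn's lemma gives a maximal graph above [G0], and
    [partial_additive_step] would enlarge it if some [y] were missing from its domain. *)
Lemma partial_additive_extension (G0 : set (Y * D)) :
  partial_additive G0 ->
  exists f : Y -> D, zmod_morphism f /\ forall y d, G0 (y, d) -> f y = d.
Proof.
move=> hG0.
pose P G := G = set0 \/ (partial_additive G /\ G0 `<=` G).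
have [F FP Ftot|G [PG Gmax]] := @Zorn_bigcup _ P.
  have [[A0 FA0 A0n]|nF] := pselect (exists2 A, F A & A <> set0); last first.
    left; apply/seteqP; split=> // x [A FA Ax]; apply: nF.
    by exists A => // A0; rewrite A0 in Ax.
  have good A x : F A -> A x -> partial_additive A /\ G0 `<=` A.
    by move=> /FP[->|].
  have [hA0 GA0] : partial_additive A0 /\ G0 `<=` A0 by case: (FP _ FA0).
  right; split; last by move=> x /GA0; exists A0.
  split.
  - by exists A0 => //; case: hA0.
  - move=> u v [A FA Au] [B FB Bv].
    have [AB|BA] := Ftot _ _ FA FB.
      by exists B => //; have [[_ BB _] _] := good _ _ FB Bv; apply/BB/Bv/AB.
    by exists A => //; have [[_ AA _] _] := good _ _ FA Au; apply: AA => //; apply: BA.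
  - by move=> d [A FA Ad]; have [[_ _ A1] _] := good _ _ FA Ad; apply: A1.
have [hG G0G] : partial_additive G /\ G0 `<=` G.
  case: PG => // GE; case: (Gmax G0); last by right; split.
  rewrite GE; split=> //; case: hG0 => G00 _ _ /(_ _ G00); exact.
have tot y : exists d, G (y, d).
  have [d hd] := partial_additive_step y hG.
  (* The subgroup generated by [G] and [(y, d)]; the choice of [d] is what keeps it
     single-valued. *)
  pose B := [set u | exists k v, G v /\ u = v + (y, d) *~ k].
  have [_ _ G1] := hG.
  have GB : G `<=` B by move=> u Gu; exists 0, u; rewrite mulr0z addr0.
  have By : B (y, d) by exists 1, 0; rewrite mulr1z add0r; case: hG.
  suff hB : partial_additive B.
    have [nBG|/contrapT BG] := pselect (~ B `<=` G); last by exists d; apply: BG.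
    by case: (Gmax B) => //; right; split=> //; apply: subset_trans GB.
  split=> [|u v [k [u' [Gu ->]]] [l [v' [Gv ->]]]|e [k [v [Gv]]]].
  - by apply: GB; case: hG.
  - exists (k - l), (u' - v'); split; first by case: hG => _ + _; apply.
    by rewrite mulrzBr opprD addrACA.
  rewrite pair_mulrz; case: v Gv => v1 v2 Gv [v1E ->].
  have {}v1E : v1 = y *~ (- k) by rewrite mulrNz; apply/eqP; rewrite -addr_eq0 -v1E.
  by rewrite v1E in Gv; rewrite (hd _ _ Gv) mulrNz addNr.
pose f y := projT1 (cid (tot y)).
have Gf y : G (y, f y) by rewrite /f; case: cid.
exists f; split=> [x y|y d /G0G Gd]; last exact: partial_additive_fun (Gf y) Gd.
apply: (partial_additive_fun hG (Gf _)).
by case: hG => _ /(_ _ _ (Gf x) (Gf y)).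
Qed.

End AdditiveExtension.

Definition rat_int : zmodClosed rat :=
  GRing.ZmodClosed.clone rat Num.int_num_subdef _.

Definition QmodZ : Type := Quotient.quot rat_int.

HB.instance Definition _ := GRing.Zmodule.on QmodZ.

Definition QmodZ_pi (x : rat) : QmodZ := \pi_(Quotient.quot rat_int) x.

Lemma QmodZ_piMz x (k : int) : QmodZ_pi x *~ k = QmodZ_pi (x *~ k).
Proof. by rewrite /QmodZ_pi raddfMz. Qed.

Lemma QmodZ_pi_eq0 x : (QmodZ_pi x == 0) = (x \is a Num.int).
Proof. by rewrite -[0](raddf0 \pi_(Quotient.quot rat_int)) -Quotient.idealrBE subr0. Qed.

Lemma QmodZ_divisible n (d : QmodZ) : (0 < n)%N -> exists d', d' *+ n = d.
Proof.
move=> n0; exists (QmodZ_pi (repr d / n%:R)).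
have divK (x : rat) : x / n%:R *~ n = x.
  by rewrite -pmulrn -[LHS]mulr_natr divfK ?pnatr_eq0 -?lt0n.
by rewrite [LHS]pmulrn QmodZ_piMz [X in QmodZ_pi X]divK; apply: reprK.
Qed.

(** Q/Z is a cogenerator. It suffices to find a nonzero [d] killed by every integer [k] with [k y]
    in [G]: then the map that is 0 on [G] and [d] at [y] is well defined on the subgroup they
    generate, and it extends by divisibility. *)
Lemma QmodZ_separation (Y : zmodType) (G : Y -> Prop) (y : Y) :
  G 0 -> (forall u v, G u -> G v -> G (u - v)) -> ~ G y ->
  exists f : Y -> QmodZ,
    [/\ zmod_morphism f, forall u, G u -> f u = 0 & f y <> 0].
Proof.
move=> G0 GB Gy.
have GN u : G u -> G (- u) by move=> Gu; rewrite -sub0r; apply: GB.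
have GMz u k : G u -> G (u *~ k).
  have GM n : G u -> G (u *+ n).
    move=> Gu; elim: n => [|n IH]; rewrite ?mulr0n //.
    by rewrite mulrSr -[u in _ + u]opprK; apply: GB => //; apply: GN.
  case: k => n Gu; rewrite ?NegzE ?mulrNz -pmulrn; first exact: GM.
  exact/GN/GM.
have [d [d0 Gd]] : exists d : QmodZ, d <> 0 /\ forall k, G (y *~ k) -> d *~ k = 0.
  pose p n := `[< (0 < n)%N /\ G (y *+ n) >].
  have abs (k : int) : k != 0 -> G (y *~ k) -> p `|k|%N.
    move=> k0 Gk; apply/asboolP; split; first by rewrite absz_gt0.
    case: k k0 Gk => n _ //.
    by rewrite NegzE abszN mulrNz -pmulrn => /GN; rewrite opprK.
  have [ep|np] := pselect (exists n, p n); last first.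
    (* Here [y] has infinite order modulo [G], and the class of 1/2 is just some nonzero element. *)
    exists (QmodZ_pi (1 / 2)); split=> [/eqP|k Gk]; first by rewrite QmodZ_pi_eq0.
    have [->|/abs/(_ Gk) pk] := eqVneq k 0; first by rewrite mulr0z.
    by case: np; exists `|k|%N.
  case: (ex_minnP ep) => n /asboolP[n0 Gn] minn.
  have nK : (n%:R : rat) != 0 by rewrite pnatr_eq0 -lt0n.
  (* Here [y] has order [n] modulo [G]. The class of 1/n vanishes only for n = 1, which would put
     [y] in [G]. *)
  exists (QmodZ_pi (n%:R^-1)); split=> [/eqP|k Gk].
    rewrite QmodZ_pi_eq0 => /intrP[m mE].
    have mn1 : m * n = 1.
      by apply/eqP; rewrite -(eqr_int rat) intrM -mE mulVf.
    apply: Gy; rewrite -[y]mulr1z -mn1 mulrC mulrzA -pmulrn; exact: GMz.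
  have Gr : G (y *~ (k %% n)%Z).
    by rewrite /modz mulrzBr mulrC mulrzA -pmulrn; apply: GB => //; apply: GMz.
  have r0 : (k %% n)%Z = 0.
    apply/eqP; apply: contraT => /abs/(_ Gr)/minn.
    by rewrite leqNgt -ltz_nat gez0_abs ?modz_ge0 ?ltz_pmod // gt_eqF.
  apply/eqP; rewrite QmodZ_piMz QmodZ_pi_eq0 (divz_eq k n) r0 addr0 mulrC mulrzA.
  by rewrite -pmulrn -[X in X *~ _]mulr_natr mulVf // intr_int.
pose G0' (u : Y * QmodZ) := exists k v, G v /\ u = (v + y *~ k, d *~ k).
have [|f [fB fE]] := @partial_additive_extension Y _ QmodZ_divisible G0'.
  split=> [|_ _ [k [u [Gu ->]]] [l [v [Gv ->]]]|e [k [v [Gv [/eqP v0 ->]]]]].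
  - by exists 0, 0; rewrite !mulr0z addr0.
  - exists (k - l), (u - v); split; first exact: GB.
    by rewrite !mulrzBr addrACA -opprD.
  - apply: Gd; rewrite eq_sym addrC addr_eq0 in v0.
    by rewrite (eqP v0); apply: GN.
exists f; split=> //.
- by move=> u Gu; apply: fE; exists 0, u; rewrite !mulr0z addr0.
- suff -> : f y = d by [].
  by apply: fE; exists 1, 0; rewrite !mulr1z add0r.
Qed.

(** * Right exactness of the tensor product *)

Section TensorExactness.
Variables (A : pzRingType) (D : lmodType A^c).

Lemma tensor_map_ext (M : lmodType A) (V : zmodType) (h h' : tensor D M -> V) :
  zmod_morphism h -> zmod_morphism h' ->
  (forall d m, h (tpure d m) = h' (tpure d m)) -> h =1 h'.
Proof.
move=> hB hB' hh; elim/tensor_ind => [|x y Hx Hy|//].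
  by rewrite -[0 in LHS](subrr 0) -[0 in RHS](subrr 0) hB hB' !subrr.
by rewrite hB hB' Hx Hy.
Qed.

Lemma tensor_map_surjective (D' : lmodType A^c) (M M' : lmodType A)
    (f : {linear D -> D'}) (g : {linear M -> M'}) :
  surjective f -> surjective g -> surjective (tensor_map f g).
Proof.
move=> fs gs; elim/tensor_ind => [|x y [x' <-] [y' <-]|d m].
- by exists 0; rewrite raddf0.
- by exists (x' - y'); rewrite raddfB.
- have [[d' <-] [m' <-]] := (fs d, gs m).
  by exists (tpure d' m'); rewrite tensor_map_pure.
Qed.

(* A character of D (x) M2 killing the image of D (x) M1 induces one of D (x) M3,
   so the kernel of D (x) g cannot be separated from that image. *)
Lemma tensor_right_exact (M1 M2 M3 : lmodType A)
    (f : {linear M1 -> M2}) (g : {linear M2 -> M3}) :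
  surjective g -> exact_at f g ->
  exact_at (tensor_map (idfun : {linear D -> D}) f)
           (tensor_map (idfun : {linear D -> D}) g).
Proof.
move=> gs fg z; split=> [gz0|[x <-]]; last first.
  elim/tensor_ind: x => [|x y Hx Hy|d m]; first by rewrite !raddf0.
    by rewrite !raddfB /= Hx Hy subrr.
  rewrite !tensor_map_pure (exact_at_comp0 _ fg).
  by apply: (addIr (tpure d 0)); rewrite add0r -tpureDr addr0.
apply: contrapT => nz.
have [||phi [phiB phi0 []]] := @QmodZ_separation _
  (fun z => exists x, tensor_map (idfun : {linear D -> D}) f x = z) z _ _ nz.
- by exists 0; rewrite raddf0.
- by move=> _ _ [x <-] [y <-]; exists (x - y); rewrite raddfB.
have phiD x y : phi (x + y) = phi x + phi y.
  pose phi' := HB.pack_for {additive tensor D M2 -> QmodZ} phi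
    (GRing.isZmodMorphism.Build _ _ phi phiB).
  exact: (raddfD phi').
(* A merely set-theoretic section is enough: by [indep] the value of [phi] on a pure tensor depends
   on its second entry only through [g]. *)
have [s gs'] : {s : M3 -> M2 | forall m, g (s m) = m}.
  by exists (fun m => projT1 (cid (gs m))) => m; case: cid.
have indep d m m' : g m = g m' -> phi (tpure d m) = phi (tpure d m').
  move=> mm'; have /fg[x xE] : g (m - m') = 0 by rewrite linearB mm' subrr.
  rewrite -[m in LHS](subrK m') tpureDr phiD phi0 ?add0r //.
  by exists (tpure d x); rewrite tensor_map_pure xE.
pose b d m := phi (tpure d (s m)).
have bbal : balanced b.
  split=> [m d d'|d m m'|a d m]; first by rewrite /b tpureDl phiD.
    by rewrite /b -phiD -tpureDr; apply: indep; rewrite linearD !gs'.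
  by rewrite /b tpureM; apply: indep; rewrite linearZ /= !gs'.
have liftB := tensor_lift_additive bbal.
have E := @tensor_map_ext _ _ phi
  (tensor_lift b \o tensor_map (idfun : {linear D -> D}) g) phiB.
rewrite E /= => [|x y|d m]; last 2 first.
- by rewrite /= raddfB liftB.
- by rewrite /= tensor_map_pure tensor_lift_pure //; apply: indep; rewrite gs'.
by rewrite gz0 -(subrr 0) liftB subrr.
Qed.

End TensorExactness.

(** * Lifting and extending maps along exact sequences *)

Section KernelMaps.
Variables (A : pzRingType).

Lemma ker_corestrict (X Y Z : lmodType A) (f : {linear X -> Y})
    (g : {linear Y -> Z}) :
  (forall x, g (f x) = 0) ->
  {h : {linear X -> ker g} | forall x, ker_val (h x) = f x}.
Proof.
move=> gf0; have gfP x : ker_pred g (f x) by apply/eqP.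
have h_lin : linear (fun x => Ker (gfP x)).
  by move=> a x y; apply: val_inj; rewrite /= linearP.
by exists (mklin h_lin).
Qed.

Lemma projective_lift (P X Y Z : lmodType A) (f : {linear X -> Y})
    (g : {linear Y -> Z}) (u : {linear P -> Y}) :
  projective P -> exact_at f g -> (forall x, g (u x) = 0) ->
  exists v : {linear P -> X}, forall x, f (v x) = u x.
Proof.
move=> projP fg gu0.
have [f' f'E] := ker_corestrict (fun x => exact_at_comp0 x fg).
have [u' u'E] := ker_corestrict gu0.
have [|v vE] := projP _ _ f' u'.
  move=> y; have /fg[x xE] := ker_valP y.
  by exists x; apply: val_inj; rewrite /= f'E.
by exists v => x; rewrite -f'E vE u'E.
Qed.

(* u factors through the image of g, which is the kernel of h. *)
Lemma injective_extend (J X Y Z W : lmodType A) (f : {linear X -> Y})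
    (g : {linear Y -> Z}) (h : {linear Z -> W}) (u : {linear Y -> J}) :
  injective_module J -> exact_at f g -> exact_at g h ->
  (forall x, u (f x) = 0) ->
  exists v : {linear Z -> J}, forall x, v (g x) = u x.
Proof.
move=> injJ fg gh uf0.
pose s (z : ker h) := projT1 (cid ((gh (ker_val z)).1 (ker_valP z))).
have gs z : g (s z) = ker_val z by rewrite /s; case: cid.
have u0 y : g y = 0 -> u y = 0 by move=> /fg[x <-].
have us_lin : linear (fun z => u (s z)).
  move=> a y z; apply/eqP; rewrite -subr_eq0 -linearP -linearB; apply/eqP/u0.
  by rewrite linearB linearP !gs subrr.
have [v vE] := injJ _ _ (ker_incl h) (mklin us_lin) val_inj.
exists v => x; have hgx : ker_pred h (g x) by apply/eqP; apply: exact_at_comp0 gh.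
rewrite -[g x]/(ker_incl h (Ker hgx)) vE /=; apply/eqP.
by rewrite -subr_eq0 -linearB; apply/eqP/u0; rewrite linearB gs subrr.
Qed.

Lemma exact_lift (X Y Z V : lmodType A) (f : {linear X -> Y})
    (g : {linear Y -> Z}) (u : {linear V -> Y}) :
  injective f -> exact_at f g -> (forall x, g (u x) = 0) ->
  exists v : {linear V -> X}, forall x, f (v x) = u x.
Proof.
move=> finj fg gu0.
pose v x := projT1 (cid ((fg (u x)).1 (gu0 x))).
have fv x : f (v x) = u x by rewrite /v; case: cid.
have v_lin : linear v by move=> a x y; apply: finj; rewrite linearP !fv linearP.
by exists (mklin v_lin).
Qed.

Lemma exact_factor (X Y Z V : lmodType A) (f : {linear X -> Y})
    (g : {linear Y -> Z}) (u : {linear Y -> V}) :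
  surjective g -> exact_at f g -> (forall x, u (f x) = 0) ->
  exists v : {linear Z -> V}, forall x, v (g x) = u x.
Proof.
move=> gs fg uf0.
pose s z := projT1 (cid (gs z)).
have gsK z : g (s z) = z by rewrite /s; case: cid.
have u0 y : g y = 0 -> u y = 0 by move=> /fg[x <-].
have us_lin : linear (fun z => u (s z)).
  move=> a y z; apply/eqP; rewrite -subr_eq0 -linearP -linearB; apply/eqP/u0.
  by rewrite linearB linearP !gsK subrr.
exists (mklin us_lin) => x /=; apply/eqP.
by rewrite -subr_eq0 -linearB; apply/eqP/u0; rewrite linearB gsK subrr.
Qed.

End KernelMaps.

(** * Injective coresolutions *)

(* A is viewed as a (Z, A)-bimodule, so that Hom_Z(A, V) is a left A-module. *)
Section Cofree.
Variable A : pzRingType.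

Definition zbimod : Type := A.

HB.instance Definition _ := GRing.Lmodule.copy zbimod (zmodule A).

Definition zbimod_ract (x : zbimod) (a : A) : zbimod := (x : A) * a.

Lemma zbimod_ractA x a b : zbimod_ract (zbimod_ract x a) b = zbimod_ract x (a * b).
Proof. by rewrite /zbimod_ract mulrA. Qed.
Lemma zbimod_ract1 x : zbimod_ract x 1 = x.
Proof. exact: mulr1. Qed.
Lemma zbimod_ractDl a : {morph zbimod_ract^~ a : x y / x + y}.
Proof. by move=> x y; apply: mulrDl. Qed.
Lemma zbimod_ractDr x : {morph zbimod_ract x : a b / a + b}.
Proof. by move=> a b; apply: mulrDr. Qed.
Lemma zbimod_ractZ (s : int) x a :
  zbimod_ract (s *: x) a = s *: zbimod_ract x a.
Proof. exact: mulrzAl. Qed.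

HB.instance Definition _ := isBimodule.Build int A zbimod
  zbimod_ractA zbimod_ract1 zbimod_ractDl zbimod_ractDr zbimod_ractZ.

Definition cofree (V : zmodType) : lmodType A := bhom zbimod (zmodule V).

Section CofreeMap.
Variables (Y : lmodType A) (V : zmodType) (f : Y -> V).
Hypothesis fB : zmod_morphism f.

Let f' := HB.pack_for {additive Y -> V} f (GRing.isZmodMorphism.Build _ _ f fB).

Lemma cofree_at_linear y : linear (fun a : zbimod => f ((a : A) *: y) : zmodule V).
Proof.
move=> k a b; rewrite scalerDl [LHS](raddfD f'); congr (_ + _).
have kaE : (k *: a : zbimod) = (a : A) *~ k by [].
by rewrite kaE -scalerMzl; apply: (raddfMz f').
Qed.

Definition cofree_at (y : Y) : cofree V := mklin (cofree_at_linear y).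

Lemma cofree_map_linear : linear cofree_at.
Proof.
move=> a x y; apply: hom_ext => b /=.
by rewrite scalerDr scalerA; apply: (raddfD f').
Qed.

Definition cofree_map : {linear Y -> cofree V} := mklin cofree_map_linear.

End CofreeMap.

(** By the adjunction Hom_A(Y, Hom_Z(A, V)) = Hom_Z(Y, V), the map [u] corresponds to the additive
    map [u1], obtained by evaluating at 1. That map extends along [i] since [V] is divisible, and
    [cofree_map] transposes the extension back. *)
Lemma cofree_injective (V : zmodType) :
  (forall n (d : V), (0 < n)%N -> exists d', d' *+ n = d) ->
  injective_module (cofree V).
Proof.
move=> Vdiv X Y i u iinj.
pose u1 x : V := (u x : {linear zbimod -> zmodule V}) (1 : A).
have u1B : zmod_morphism u1 by move=> x y; rewrite /u1 linearB.
pose G (p : Y * V) := exists x, p = (i x, u1 x).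
have [|f [fB fE]] := @partial_additive_extension Y V Vdiv G.
  split=> [|_ _ [x ->] [y ->]|d [x [/eqP x0 ->]]].
  - by exists 0; rewrite linear0 /u1 linear0.
  - by exists (x - y); rewrite u1B linearB.
  - rewrite eq_sym -(linear0 i) (inj_eq iinj) in x0.
    by rewrite (eqP x0) /u1 linear0.
exists (cofree_map fB) => x; apply: hom_ext => a.
rewrite /= -linearZ (fE _ (u1 (a *: x))); last by exists (a *: x).
rewrite /u1 linearZ /=; congr ((u x : {linear _ -> _}) _); exact: mul1r.
Qed.

End Cofree.

(** The cokernel of [f] is embedded in an injective without being formed: [g] collects all
    characters of [M] that kill the image of [f], and these separate that image from every other
    element. *)
Lemma injective_cokernel (A : pzRingType) (X M : lmodType A) (f : {linear X -> M}) :
  exists J : lmodType A, exists2 g : {linear M -> J},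
    injective_module J & exact_at f g.
Proof.
pose Phi := {phi : M -> QmodZ | zmod_morphism phi /\ forall x, phi (f x) = 0}.
pose ev (m : M) (phi : Phi) : QmodZ := sval phi m.
have evB : zmod_morphism ev by move=> x y; apply/funext => -[phi [phiB ?]]; apply: phiB.
exists (cofree A (Phi -> QmodZ)), (cofree_map evB).
  apply: cofree_injective => n d n0.
  exists (fun phi => projT1 (cid (QmodZ_divisible (d phi) n0))).
  apply/funext => phi; rewrite natmulfctE; case: cid => e /= <-.
  by [].
move=> m; split=> [m0|[x <-]]; last first.
  apply: hom_ext => a; apply/funext => -[phi [phiB phi0]].
  by rewrite /= /ev /= -linearZ phi0.
apply: contrapT => nm.
have [||phi [phiB phi0 []]] :=
    @QmodZ_separation _ (fun m => exists x, f x = m) m _ _ nm.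
- by exists 0; rewrite linear0.
- by move=> _ _ [x <-] [y <-]; exists (x - y); rewrite linearB.
have phiP : zmod_morphism phi /\ forall x, phi (f x) = 0.
  by split=> // x; apply: phi0; exists x.
(* The value of [m0] at 1, in the coordinate [phi], reads [phi m = 0]. *)
have := congr1 (fun h : cofree A (Phi -> QmodZ) =>
  (h : {linear zbimod A -> zmodule (Phi -> QmodZ)}) (1 : A)
    (exist _ phi phiP)) m0.
by rewrite /= /ev /= scale1r.
Qed.

Section InjectiveCoresolution.
Variables (A : pzRingType) (M : lmodType A).

(** Bundling a map with its source and target lets the coresolution be built by recursion in a
    single type. *)
Record arrow := Arrow {
  arrow_src : lmodType A;
  arrow_tgt : lmodType A;
  arrow_map : {linear arrow_src -> arrow_tgt}
}.

Definition arrow_cokernel (f : arrow) : arrow :=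
  let J := cid (injective_cokernel (arrow_map f)) in
  Arrow (s2val (cid2 (svalP J))).

Lemma arrow_cokernelP f :
  injective_module (arrow_tgt (arrow_cokernel f)) /\
  exact_at (arrow_map f) (arrow_map (arrow_cokernel f)).
Proof. by rewrite /=; case: (cid2 _). Qed.

(** The seed is the zero endomorphism of [M], so exactness after it makes arrow 0 injective on [M].
    The source of each later arrow reduces to the target of the preceding one, so consecutive arrows
    compose. *)
Fixpoint coresolution_arrow n : arrow :=
  arrow_cokernel
    (if n is n'.+1 then coresolution_arrow n' else Arrow (\0 : {linear M -> M})).

Lemma injective_coresolution_exists :
  exists I : aug_cochain M, injective_coresolution I.
Proof.
have exS n : exact_at (arrow_map (coresolution_arrow n))
    (arrow_map (coresolution_arrow n.+1)).
  by exact: (arrow_cokernelP _).2.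
have [_ ex0] := arrow_cokernelP (Arrow (\0 : {linear M -> M})).
exists (@AugCochain A M (fun n => arrow_tgt (coresolution_arrow n))
  (fun n => arrow_map (coresolution_arrow n.+1))
  (arrow_map (coresolution_arrow 0))
  (fun n x => exact_at_comp0 x (exS n.+1)) (fun x => exact_at_comp0 x (exS 0))).
split=> [[|n]|]; [exact: (arrow_cokernelP _).1..|].
split=> [||n]; [|exact: (exS 0)|exact: (exS n.+1)].
move=> x y xy; apply/eqP; rewrite -subr_eq0; apply/eqP.
have /ex0[z <-] // : arrow_map (coresolution_arrow 0) (x - y) = 0.
by rewrite linearB /= xy subrr.
Qed.

End InjectiveCoresolution.

(** * Balancing Ext *)

Section CohomologicalDoubleComplex.
Variables (H : nat -> nat -> zmodType).
Variables (a : forall n k, H n k -> H n.+1 k) (b : forall n k, H n k -> H n k.+1).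
Hypothesis aB : forall n k, zmod_morphism (@a n k).
Hypothesis bB : forall n k, zmod_morphism (@b n k).
Hypothesis abC : forall n k x, a (@b n k x) = b (a x).
Hypothesis a_inj : forall k x, @a 0 k.+1 x = 0 -> x = 0.
Hypothesis a_exact : forall n k, exact_at (@a n k.+1) (@a n.+1 k.+1).
Hypothesis b_inj : forall n x, @b n.+1 0 x = 0 -> x = 0.
Hypothesis b_exact : forall n k, exact_at (@b n.+1 k) (@b n.+1 k.+1).
Hypothesis b0_exact : forall k, exact_at (@b 0 k.+1) (@b 0 k.+2).

Let a0 n k : @a n k 0 = 0.
Proof. by rewrite -[0 in LHS](subrr 0) aB subrr. Qed.
Let b0 n k : @b n k 0 = 0.
Proof. by rewrite -[0 in LHS](subrr 0) bB subrr. Qed.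

(** Index 0 in either direction is the augmentation edge. The chase runs down an antidiagonal: if
    [a g = z], then [b g] is again killed by both differentials and has smaller first index; the
    induction hypothesis for it supplies the correction that turns [g] into a [b]-cycle. *)
Lemma double_complex_lift n k (z : H n.+1 k.+1) :
  a z = 0 -> b z = 0 -> exists2 l, b l = 0 & a l = z.
Proof.
elim: n k z => [|n IH] k z az bz.
  have [l lz] := (a_exact z).1 az; exists l => //.
  by apply: a_inj; rewrite abC lz.
have [g gz] := (a_exact z).1 az.
have [||l bl al] := IH _ (b g); first by rewrite abC gz.
  by apply/b_exact; exists g.
have [l' l'E] : exists l', b l' = l.
  by case: n IH z az bz g gz l bl al => [|n] _ z az bz g gz l bl al;
    [apply/b0_exact | apply/b_exact].
exists (g - a l'); first by rewrite bB -abC l'E al subrr.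
by rewrite aB gz (exact_at_comp0 _ (@a_exact _ _)) subr0.
Qed.

(** Exactness passes from the edge with first index 0 to the edge with second index 0: a cycle [z]
    is pushed off its edge by [b], lifted along [a] to a [b]-cycle, and brought back by exactness of
    [b]. *)
Lemma double_complex_exact n : exact_at (@a n.+1 0) (@a n.+2 0).
Proof.
have aa m x : a (@a m.+1 0 x) = 0.
  by apply: b_inj; rewrite -!abC (exact_at_comp0 _ (@a_exact _ _)).
move=> z; split=> [az|[x <-]]; last exact: aa.
have [||l bl al] := @double_complex_lift n.+1 0 (b z).
- by rewrite abC az b0.
- by rewrite (exact_at_comp0 _ (@b_exact _ _)).
have [l' l'E] := (b_exact l).1 bl.
exists l'; apply/eqP; rewrite -subr_eq0; apply/eqP/b_inj.
by rewrite bB -abC l'E al subrr.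
Qed.

End CohomologicalDoubleComplex.

Section HomologicalDoubleComplex.
Variables (H : nat -> nat -> zmodType).
Variables (a : forall n k, H n.+1 k -> H n k) (b : forall n k, H n k.+1 -> H n k).
Hypothesis aB : forall n k, zmod_morphism (@a n k).
Hypothesis bB : forall n k, zmod_morphism (@b n k).
Hypothesis abC : forall n k x, a (@b n.+1 k x) = b (@a n k.+1 x).
Hypothesis a_surj : forall k, surjective (@a 0 k.+1).
Hypothesis a_exact : forall n k, exact_at (@a n.+1 k.+1) (@a n k.+1).
Hypothesis b_surj : forall n, surjective (@b n.+1 0).
Hypothesis b_exact : forall n k, exact_at (@b n.+1 k.+1) (@b n.+1 k).
Hypothesis b0_exact : forall k, exact_at (@b 0 k.+2) (@b 0 k.+1).

Let a0 n k : @a n k 0 = 0.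
Proof. by rewrite -[0 in LHS](subrr 0) aB subrr. Qed.
Let b0 n k : @b n k 0 = 0.
Proof. by rewrite -[0 in LHS](subrr 0) bB subrr. Qed.

(** Dual chase: if [b w = z], then [a w] is killed by both differentials and has smaller first
    index. At the edge [b0_exact] and [a_surj] give the correction of [w], elsewhere the induction
    hypothesis and [a_exact] do. *)
Lemma double_complex_colift n k (z : H n.+1 k.+1) :
  a z = 0 -> b z = 0 -> exists2 w, a w = 0 & b w = z.
Proof.
elim: n k z => [|n IH] k z az bz.
all: have [w wz] := (b_exact z).1 bz.
  have [w' w'E] : exists w', b w' = a w by apply/b0_exact; rewrite -abC wz.
  have [w'' w''E] := a_surj w'.
  exists (w - b w''); first by rewrite aB abC w''E w'E subrr.
  by rewrite bB wz (exact_at_comp0 _ (@b_exact _ _)) subr0.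
have [||w' aw' bw'] := IH _ (a w); first by apply/a_exact; exists w.
  by rewrite -abC wz.
have [w'' w''E] := (a_exact w').1 aw'.
exists (w - b w''); first by rewrite aB abC w''E bw' subrr.
by rewrite bB wz (exact_at_comp0 _ (@b_exact _ _)) subr0.
Qed.

(** A preimage [w] of the cycle under [b] is corrected to an [a]-cycle; that is an [a]-boundary, and
    its image under [b] is the boundary sought. *)
Lemma double_complex_coexact n : exact_at (@a n.+2 0) (@a n.+1 0).
Proof.
have aa m x : a (@a m.+2 0 x) = 0.
  have [y <-] := b_surj x.
  by rewrite !abC (exact_at_comp0 _ (@a_exact _ _)) b0.
move=> z; split=> [az|[x <-]]; last exact: aa.
have [w wz] := b_surj z.
have [||w' aw' bw'] := @double_complex_colift n 0 (a w).
- by rewrite (exact_at_comp0 _ (@a_exact _ _)).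
- by rewrite -abC wz.
have [w'' w''E] := (a_exact w').1 aw'.
have /a_exact[v vE] : a (w - b w'') = 0.
  by rewrite aB abC w''E bw' subrr.
exists (b v); rewrite abC vE bB wz.
by rewrite (exact_at_comp0 _ (@b_exact _ _)) subr0.
Qed.

End HomologicalDoubleComplex.

(** * Hom out of a projective resolution and into an injective coresolution *)

Section AugmentedComplexes.
Variables (A : pzRingType) (M : lmodType A).

Section Chain.
Variable X : aug_chain M.

(** Placing the augmented module in degree 0 shifts the complex by one, so that the edges of the
    double complexes below need no separate indexing. *)
Definition aug_ob n : lmodType A := if n is n'.+1 then X n' else M.

Definition aug_d n : {linear aug_ob n.+1 -> aug_ob n} :=
  if n is n'.+1 then ac_d X n' else ac_eps X.

Lemma aug_d_exact n : aug_chain_exact X -> exact_at (aug_d n.+1) (aug_d n).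
Proof. by case=> _ ex0 exS; case: n => [|n]; [apply: ex0 | apply: exS]. Qed.

Lemma aug_d_surjective : aug_chain_exact X -> surjective (aug_d 0).
Proof. by case. Qed.

End Chain.

Section Cochain.
Variable X : aug_cochain M.

Definition coaug_ob n : lmodType A := if n is n'.+1 then X n' else M.

Definition coaug_d n : {linear coaug_ob n -> coaug_ob n.+1} :=
  if n is n'.+1 then cc_d X n' else cc_eta X.

Lemma coaug_d_exact n : aug_cochain_exact X -> exact_at (coaug_d n) (coaug_d n.+1).
Proof. by case=> _ ex0 exS; case: n => [|n]; [apply: ex0 | apply: exS]. Qed.

Lemma coaug_d_injective : aug_cochain_exact X -> injective (coaug_d 0).
Proof. by case. Qed.

End Cochain.

End AugmentedComplexes.

Section HomExactness.
Variables (A : pzRingType).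

Lemma hom_preB (U U' V : lmodType A) (g : {linear U' -> U}) :
  zmod_morphism (@hom_pre A U U' V g).
Proof. by move=> f h; apply: hom_ext. Qed.

Lemma hom_postB (U V V' : lmodType A) (g : {linear V -> V'}) :
  zmod_morphism (@hom_post A U V V' g).
Proof. by move=> f h; apply: hom_ext => x; apply: linearB. Qed.

Lemma hom_pre_injective (U U' V : lmodType A) (g : {linear U' -> U}) :
  surjective g -> forall f : hom U V, hom_pre g f = 0 -> f = 0.
Proof.
move=> gs f f0; apply: hom_ext => x; have [y <-] := gs x.
exact: (congr1 (fun h : hom U' V => (h : {linear _ -> _}) y) f0).
Qed.

Lemma hom_post_injective (U V V' : lmodType A) (g : {linear V -> V'}) :
  injective g -> forall f : hom U V, hom_post g f = 0 -> f = 0.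
Proof.
move=> gi f f0; apply: hom_ext => x; apply: gi; rewrite linear0.
exact: (congr1 (fun h : hom U V' => (h : {linear _ -> _}) x) f0).
Qed.

Lemma hom_pre_exact (J X Y Z W : lmodType A) (f : {linear X -> Y})
    (g : {linear Y -> Z}) (h : {linear Z -> W}) :
  injective_module J -> exact_at f g -> exact_at g h ->
  exact_at (@hom_pre A _ _ J g) (@hom_pre A _ _ J f).
Proof.
move=> injJ fg gh u; split=> [uf0|[v <-]].
  have [x|v vE] := @injective_extend _ _ _ _ _ _ _ _ _ u injJ fg gh.
    exact: (congr1 (fun h : hom X J => (h : {linear _ -> _}) x) uf0).
  by exists v; apply: hom_ext.
by apply: hom_ext => x; rewrite /= (exact_at_comp0 _ fg) linear0.
Qed.

Lemma hom_post_exact (P X Y Z : lmodType A) (f : {linear X -> Y})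
    (g : {linear Y -> Z}) :
  projective P -> exact_at f g ->
  exact_at (@hom_post A P _ _ f) (@hom_post A P _ _ g).
Proof.
move=> projP fg u; split=> [gu0|[v <-]].
  have [x|v vE] := @projective_lift _ _ _ _ _ _ _ u projP fg.
    exact: (congr1 (fun h : hom P Z => (h : {linear _ -> _}) x) gu0).
  by exists v; apply: hom_ext.
by apply: hom_ext => x; rewrite /= (exact_at_comp0 _ fg).
Qed.

End HomExactness.

Section Balancing.
Variables (A : pzRingType) (V N : lmodType A).
Variables (P : aug_chain V) (I : aug_cochain N).
Hypotheses (resP : projective_resolution P) (coresI : injective_coresolution I).

Let a n k : hom (aug_ob P n) (coaug_ob I k) -> hom (aug_ob P n.+1) (coaug_ob I k) :=
  @hom_pre A _ _ _ (aug_d P n).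
Let b n k : hom (aug_ob P n) (coaug_ob I k) -> hom (aug_ob P n) (coaug_ob I k.+1) :=
  @hom_post A _ _ _ (coaug_d I k).

Let a_inj k x : @a 0 k x = 0 -> x = 0.
Proof. by apply: hom_pre_injective; apply: aug_d_surjective; case: resP. Qed.

Let b_inj n x : @b n 0 x = 0 -> x = 0.
Proof. by apply: hom_post_injective; apply: coaug_d_injective; case: coresI. Qed.

Let a_exact n k : exact_at (@a n k.+1) (@a n.+1 k.+1).
Proof.
case: resP coresI => _ exP [injI _].
case: n => [|n]; last first.
  exact: (hom_pre_exact (injI k) (aug_d_exact (n := n.+1) exP)
    (aug_d_exact (n := n) exP)).
(* Surjectivity of the augmentation is expressed as exactness before a zero map. *)
apply: (hom_pre_exact (h := \0 : {linear V -> V}) (injI k) (aug_d_exact (n := 0) exP)).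
by move=> y; split=> // _; apply: aug_d_surjective.
Qed.

Let b_exact n k : exact_at (@b n.+1 k) (@b n.+1 k.+1).
Proof.
case: resP coresI => projP _ [_ exI].
exact: (hom_post_exact (projP n) (coaug_d_exact (n := k) exI)).
Qed.

(** The two sides are the edges Hom(V, I) and Hom(P, N) of the double complex Hom(P, I), whose other
    rows and columns are exact. The two implications are one chase with the indices exchanged. *)
Lemma hom_coresolution_resolution :
  (forall k, exact_at (@hom_post A V _ _ (cc_d I k)) (@hom_post A V _ _ (cc_d I k.+1)))
  <-> forall n, exact_at (@hom_pre A _ _ N (ac_d P n)) (@hom_pre A _ _ N (ac_d P n.+1)).
Proof.
have aB n k : zmod_morphism (@a n k) by apply: hom_preB.
have bB n k : zmod_morphism (@b n k) by apply: hom_postB.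
have abC n k x : a (@b n k x) = b (a x) by apply: hom_ext.
split=> ex0 n.
  exact: (double_complex_exact aB bB abC (fun k => @a_inj k.+1) a_exact
    (fun n => @b_inj n.+1) b_exact ex0).
by apply: (double_complex_exact (fun n k => bB k n) (fun n k => aB k n)
  (fun n k x => esym (abC k n x)) (fun n => @b_inj n.+1) (fun n k => @b_exact k n)
  (fun k => @a_inj k.+1) (fun n k => @a_exact k n) ex0).
Qed.

End Balancing.

(** [Ext_eq0] speaks of all projective resolutions: one direction uses the free one, the other
    transports from [I] to an arbitrary one. *)
Lemma Ext_eq0_coresolution (A : pzRingType) (V N : lmodType A) (I : aug_cochain N) :
  injective_coresolution I ->
  (forall i, (1 <= i)%N -> Ext_eq0 i V N) <->
  (forall k, exact_at (@hom_post A V _ _ (cc_d I k)) (@hom_post A V _ _ (cc_d I k.+1))).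
Proof.
move=> coresI; split=> [ext0|exI [//|i] _ P resP].
  have resF := free_resolution_projective V.
  apply/(hom_coresolution_resolution resF coresI) => n.
  by move: (ext0 n.+1 isT _ resF).
by move: i; apply/(hom_coresolution_resolution resP coresI).
Qed.

(** * Dual bases and flatness of projective modules *)

Section DualBasis.
Variables (A : pzRingType).

Lemma free_module_ind (X : choiceType) (Q : free_module A X -> Prop) :
  Q 0 -> (forall x y, Q x -> Q y -> Q (x - y)) ->
  (forall a x, Q (a *: free_gen A x)) -> forall m, Q m.
Proof.
move=> Q0 QB Qg.
have QD x y : Q x -> Q y -> Q (x + y).
  by move=> Qx Qy; rewrite -[y]opprK; apply: (QB) => //; rewrite -sub0r; apply: QB.
elim/btensor_ind => [||a m] //.
rewrite -[m]freeg_sumE; elim/big_rec: _ => [|x n _ IH].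
  suff -> : tpure a (0 : {freeg X / int}) = 0 :> free_module A X by [].
  by apply: (addIr (tpure a 0)); rewrite add0r -tpureDr addr0.
rewrite tpureDr; apply: (QD) => //; set k := coeff x m.
have -> : (<< k *g x >> : {freeg X / int}) = k *: << x >>.
  by apply/eqP/freeg_eqP => y; rewrite coeffZ !coeffU mulrA mulr1.
rewrite -tpureM.
suff -> : tpure ((k : int^c) *: a) (<< x >> : {freeg X / int})
    = ((a : A) *~ k) *: free_gen A x by [].
by rewrite [RHS]btensor_scale_pure /=; congr tpure; rewrite [RHS]mulr1.
Qed.

Lemma linear_sumZ (X : Type) (U V : lmodType A) (phi : X -> {linear U -> A^o})
    (e : X -> V) (s : seq X) :
  linear (fun u => \sum_(x <- s) (phi x u : A) *: e x).
Proof.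
move=> a u v; rewrite scaler_sumr -big_split /=; apply: eq_bigr => x _.
by rewrite linearP scalerDl scalerA.
Qed.

(* Every finite set of indices containing s computes p, so that finitely many
   elements can be expanded over a common index set. *)
Lemma projective_dual_basis (X : choiceType) (P : lmodType A) (e : X -> P) :
  projective P -> surjective (free_lift e) ->
  exists phi : X -> {linear P -> A^o}, forall p, exists s : seq X,
    forall s', uniq s' -> {subset s <= s'} ->
      p = \sum_(x <- s') (phi x p : A) *: e x.
Proof.
move=> projP es; have [h hE] := projP _ _ _ (idfun : {linear P -> P}) es.
pose coef x : {linear free_module A X -> A^o} :=
  free_lift (fun y => (y == x)%:R : A^o).
have supp m : exists s : seq X, forall s', uniq s' -> {subset s <= s'} ->
    m = \sum_(x <- s') (coef x m : A) *: free_gen A x.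
  have linS s := linear_sumZ coef (@free_gen A X) s.
  elim/free_module_ind: m => [|m n [s sE] [t tE]|a x].
  - by exists [::] => s' _ _; rewrite big1 // => x _; rewrite linear0 scale0r.
  - exists (s ++ t) => s' us' sub.
    have sub1 : {subset s <= s'} by move=> x xs; apply: sub; rewrite mem_cat xs.
    have sub2 : {subset t <= s'} by move=> x xs; apply: sub; rewrite mem_cat xs orbT.
    rewrite [LHS](f_equal2 (fun u v => u - v) (sE _ us' sub1) (tE _ us' sub2)).
    exact/esym/(linearB (mklin (linS s'))).
  - exists [:: x] => s' us' sub.
    have coefE y : (coef y (a *: free_gen A x) : A) = a * (x == y)%:R.
      by rewrite linearZ [coef y _]free_lift_gen.
    have xs' : x \in s' by apply: sub; rewrite mem_head.
    rewrite (bigD1_seq x xs' us') coefE eqxx mulr1 big1 => [|y yx].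
      exact/esym/addr0.
    by rewrite coefE eq_sym (negbTE yx) mulr0 scale0r.
(* The dual basis consists of the coordinates of a splitting [h] of the free cover. *)
exists (fun x => coef x \o h) => p; have [s sE] := supp (h p).
exists s => s' us' sub; rewrite -[LHS]hE [in LHS](sE s') // linear_sum.
by apply: eq_bigr => x _; rewrite linearZ; congr (_ *: _); exact: free_lift_gen.
Qed.

Lemma projective_basis_id (P : lmodType A) : projective P ->
  exists phi : P -> {linear P -> A^o}, forall p, exists s : seq P,
    forall s', uniq s' -> {subset s <= s'} ->
      p = \sum_(x <- s') (phi x p : A) *: x.
Proof.
by move=> projP; apply: (projective_dual_basis projP (@cover_surjective A P)).
Qed.

Lemma projective_fg_basis (P : lmodType A) :
  projective P -> finitely_generated P ->
  exists n (e : 'I_n -> P) (phi : 'I_n -> {linear P -> A^o}),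
    forall p, p = \sum_(i < n) (phi i p : A) *: e i.
Proof.
move=> projP [n [e eP]].
have [|phi phiE] := @projective_dual_basis _ P e projP.
  move=> p; have [c ->] := eP p; exists (\sum_i c i *: free_gen A i).
  by rewrite linear_sum; apply: eq_bigr => i _; rewrite linearZ free_lift_gen.
exists n, e, phi => p; have [s sE] := phiE p.
(* The list of all indices contains every [s], so the expansion no longer depends on [p]. *)
rewrite [LHS](sE (enum 'I_n)) ?enum_uniq // => [|i _]; last by rewrite mem_enum.
by rewrite big_enum.
Qed.

End DualBasis.

Section TensorProjective.
Variables (A : pzRingType).

Lemma tpure_sumr (D : lmodType A^c) (M : lmodType A) d (I : Type) (s : seq I)
    (F : I -> M) :
  tpure d (\sum_(i <- s) F i) = \sum_(i <- s) tpure d (F i) :> tensor D M.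
Proof.
have t0 : tpure d 0 = 0 :> tensor D M.
  by apply: (addIr (tpure d 0)); rewrite add0r -tpureDr addr0.
exact: (big_morph _ (@tpureDr _ D M d) t0).
Qed.

Lemma tpure_suml (D : lmodType A^c) (M : lmodType A) m (I : Type) (s : seq I)
    (F : I -> D) :
  tpure (\sum_(i <- s) F i) m = \sum_(i <- s) tpure (F i) m :> tensor D M.
Proof.
have t0 : tpure 0 m = 0 :> tensor D M.
  by apply: (addIr (tpure 0 m)); rewrite add0r -tpureDl addr0.
exact: (big_morph _ (@tpureDl _ D M m) t0).
Qed.

Section RightContraction.
Variables (D : lmodType A^c) (P : lmodType A) (phi : {linear P -> A^o}).

Lemma rcontract_balanced : balanced (fun (d : D) p => (phi p : A^c) *: d).
Proof.
split=> [p d d'|d p p'|a d p]; first exact: scalerDr.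
  by rewrite linearD scalerDl.
by rewrite linearZ scalerA.
Qed.

(** The map D (x) phi followed by the identification D (x) A = D; [lcontract] below is its mirror
    image. *)
Definition rcontract : tensor D P -> D :=
  tensor_lift (fun (d : D) p => (phi p : A^c) *: d).

Lemma rcontract_pure d p : rcontract (tpure d p) = (phi p : A^c) *: d.
Proof. exact: (tensor_lift_pure rcontract_balanced). Qed.

HB.instance Definition _ := GRing.isZmodMorphism.Build _ _ rcontract
  (tensor_lift_additive rcontract_balanced).

End RightContraction.

Section LeftContraction.
Variables (L : lmodType A^c) (M : lmodType A) (phi : {linear L -> (A^c)^o}).

Lemma lcontract_balanced : balanced (fun (l : L) (m : M) => (phi l : A) *: m).
Proof.
split=> [m l l'|l m m'|a l m]; last by rewrite linearZ scalerA.
  by rewrite linearD; apply: scalerDl.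
exact: scalerDr.
Qed.

Definition lcontract : tensor L M -> M :=
  tensor_lift (fun (l : L) (m : M) => (phi l : A) *: m).

Lemma lcontract_pure l m : lcontract (tpure l m) = (phi l : A) *: m.
Proof. exact: (tensor_lift_pure lcontract_balanced). Qed.

HB.instance Definition _ := GRing.isZmodMorphism.Build _ _ lcontract
  (tensor_lift_additive lcontract_balanced).

End LeftContraction.

(** By a dual basis, a tensor is recovered from its finitely many contractions, and contraction
    commutes with maps of the left factor. Exactness can thus be checked one coordinate at a time,
    where it is that of the given sequence. *)
Lemma projective_flat (P : lmodType A) : projective P -> flat P.
Proof.
move=> projP X Y Z f g fg.
have [phi phiE] := projective_basis_id projP.
have expand (D : lmodType A^c) (t : tensor D P) : exists s : seq P,
    forall s', uniq s' -> {subset s <= s'} ->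
      t = \sum_(x <- s') tpure (rcontract (phi x) t) x.
  elim/tensor_ind: t => [|t u [s sE] [r rE]|d p].
  - exists [::] => s' _ _; rewrite big1 // => x _; rewrite raddf0.
    by apply: (addIr (tpure 0 x)); rewrite add0r -tpureDl addr0.
  - exists (s ++ r) => s' us' sub.
    have sub1 : {subset s <= s'} by move=> x xs; apply: sub; rewrite mem_cat xs.
    have sub2 : {subset r <= s'} by move=> x xs; apply: sub; rewrite mem_cat xs orbT.
    rewrite [LHS](f_equal2 (fun u v => u - v) (sE _ us' sub1) (rE _ us' sub2)).
    rewrite -sumrB; apply: eq_bigr => x _; rewrite raddfB /=.
    by apply/eqP; rewrite subr_eq -tpureDl subrK.
  - have [s sE] := phiE p; exists s => s' us' sub.
    rewrite [in LHS](sE s') // tpure_sumr; apply: eq_bigr => x _.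
    by rewrite rcontract_pure tpureM.
have nat_contract (D D' : lmodType A^c) (h : {linear D -> D'}) x t :
    rcontract (phi x) (tensor_map h (idfun : {linear P -> P}) t) = h (rcontract (phi x) t).
  elim/tensor_ind: t => [|t u Ht Hu|d p]; first by rewrite !raddf0.
    by rewrite !raddfB /= Ht Hu.
  by rewrite tensor_map_pure !rcontract_pure linearZ.
move=> t; split=> [gt0|[u <-]].
  have [s sE] := expand _ t.
  have /choice[w wE] x : exists w, f w = rcontract (phi x) t.
    by apply/fg; rewrite -nat_contract gt0 raddf0.
  exists (\sum_(x <- undup s) tpure (w x) x).
  rewrite raddf_sum [RHS](sE (undup s)) ?undup_uniq // => [|x]; last first.
    by rewrite mem_undup.
  by apply: eq_bigr => x _; rewrite /= tensor_map_pure wE.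
elim/tensor_ind: u => [|u v Hu Hv|d p]; first by rewrite !raddf0.
  by rewrite !raddfB /= Hu Hv subrr.
rewrite !tensor_map_pure (exact_at_comp0 _ fg).
by apply: (addIr (tpure 0 p)); rewrite add0r -tpureDl addr0.
Qed.

(** The mirror image of [projective_flat]: [flat] concerns only the right-hand tensor factor, while
    here the projective module is on the left. *)
Lemma tensor_projective_exact (L : lmodType A^c) (X Y Z : lmodType A)
    (f : {linear X -> Y}) (g : {linear Y -> Z}) :
  projective L -> exact_at f g ->
  exact_at (tensor_map (idfun : {linear L -> L}) f)
           (tensor_map (idfun : {linear L -> L}) g).
Proof.
move=> projL fg.
have [phi phiE] := projective_basis_id projL.
have expand (M : lmodType A) (t : tensor L M) : exists s : seq L,
    forall s', uniq s' -> {subset s <= s'} ->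
      t = \sum_(x <- s') tpure x (lcontract (phi x) t).
  elim/tensor_ind: t => [|t u [s sE] [r rE]|l m].
  - exists [::] => s' _ _; rewrite big1 // => x _; rewrite raddf0.
    by apply: (addIr (tpure x 0)); rewrite add0r -tpureDr addr0.
  - exists (s ++ r) => s' us' sub.
    have sub1 : {subset s <= s'} by move=> x xs; apply: sub; rewrite mem_cat xs.
    have sub2 : {subset r <= s'} by move=> x xs; apply: sub; rewrite mem_cat xs orbT.
    rewrite [LHS](f_equal2 (fun u v => u - v) (sE _ us' sub1) (rE _ us' sub2)).
    rewrite -sumrB; apply: eq_bigr => x _; rewrite raddfB /=.
    by apply/eqP; rewrite subr_eq -tpureDr subrK.
  - have [s sE] := phiE l; exists s => s' us' sub.
    rewrite [in LHS](sE s') // tpure_suml; apply: eq_bigr => x _.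
    by rewrite lcontract_pure tpureM.
have nat_contract (M M' : lmodType A) (h : {linear M -> M'}) x t :
    lcontract (phi x) (tensor_map (idfun : {linear L -> L}) h t) = h (lcontract (phi x) t).
  elim/tensor_ind: t => [|t u Ht Hu|l m]; first by rewrite !raddf0.
    by rewrite !raddfB /= Ht Hu.
  by rewrite tensor_map_pure !lcontract_pure linearZ.
move=> t; split=> [gt0|[u <-]].
  have [s sE] := expand _ t.
  have /choice[w wE] x : exists w, f w = lcontract (phi x) t.
    by apply/fg; rewrite -nat_contract gt0 raddf0.
  exists (\sum_(x <- undup s) tpure x (w x)).
  rewrite raddf_sum [RHS](sE (undup s)) ?undup_uniq // => [|x]; last first.
    by rewrite mem_undup.
  by apply: eq_bigr => x _; rewrite /= tensor_map_pure wE.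
elim/tensor_ind: u => [|u v Hu Hv|l m]; first by rewrite !raddf0.
  by rewrite !raddfB /= Hu Hv subrr.
rewrite !tensor_map_pure (exact_at_comp0 _ fg).
by apply: (addIr (tpure l 0)); rewrite add0r -tpureDr addr0.
Qed.

End TensorProjective.

(** * Balancing Tor *)

Section TorFlat.
Variables (A : pzRingType).

Section Balancing.
Variables (D : lmodType A^c) (M : lmodType A).
Variables (L : aug_chain D) (F : aug_chain M).
Hypothesis (resL : projective_resolution L).
Hypotheses (exF : aug_chain_exact F) (flatF : forall n, flat (F n)).

Let H n k : zmodType := tensor (aug_ob L n) (aug_ob F k).
Let a n k : H n.+1 k -> H n k := tensor_map (aug_d L n) idfun.
Let b n k : H n k.+1 -> H n k := tensor_map idfun (aug_d F k).

Let aB n k : zmod_morphism (@a n k). Proof. exact: tensor_map_additive. Qed.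
Let bB n k : zmod_morphism (@b n k). Proof. exact: tensor_map_additive. Qed.

Let abC n k x : a (@b n.+1 k x) = b (@a n k.+1 x).
Proof.
elim/tensor_ind: x => [|x y Hx Hy|d m].
- by rewrite /a /b !raddf0.
- by rewrite !bB !aB bB Hx Hy.
- by rewrite /a /b !tensor_map_pure.
Qed.

Let id_surjective (M' : Type) : surjective (fun x : M' => x).
Proof. by move=> x; exists x. Qed.

Let a_surj k : surjective (@a 0 k).
Proof.
apply: tensor_map_surjective; last exact: id_surjective.
by apply: aug_d_surjective; case: resL.
Qed.

Let a_exact n k : exact_at (@a n.+1 k.+1) (@a n k.+1).
Proof. by apply: flatF; apply: aug_d_exact; case: resL. Qed.

Let b_surj n : surjective (@b n 0).
Proof.
apply: tensor_map_surjective; first exact: id_surjective.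
exact: aug_d_surjective.
Qed.

Let b_exact n k : exact_at (@b n.+1 k.+1) (@b n.+1 k).
Proof.
by apply: tensor_projective_exact; [case: resL => projL _; apply: projL
                                   | apply: aug_d_exact].
Qed.

(** The two sides are the edges L (x) M and D (x) F of the double complex L (x) F. Away from them,
    one direction is exact because the F_k are flat, the other because the L_n are projective. *)
Lemma tensor_resolution_exact :
  (forall n, exact_at (tensor_map (ac_d L n.+1) (idfun : {linear M -> M}))
                      (tensor_map (ac_d L n) (idfun : {linear M -> M})))
  <-> forall n, exact_at (tensor_map (idfun : {linear D -> D}) (ac_d F n.+1))
                         (tensor_map (idfun : {linear D -> D}) (ac_d F n)).
Proof.
split=> ex0 n.
  exact: (double_complex_coexact (fun n k => @bB k n) (fun n k => @aB k n)
    (fun n k x => esym (@abC k n x)) (fun k => @b_surj k.+1)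
    (fun n k => @b_exact k n) (fun n => @a_surj n.+1) (fun n k => @a_exact k n) ex0).
exact: (double_complex_coexact aB bB abC (fun k => @a_surj k.+1) a_exact
  (fun n => @b_surj n.+1) b_exact ex0).
Qed.

End Balancing.

(** Balancing is used twice, with a free resolution of [D] as intermediary between [F] and an
    arbitrary projective resolution of [M]. *)
Lemma Tor_eq0_flat_resolution (D : lmodType A^c) (M : lmodType A) (F : aug_chain M) :
  aug_chain_exact F -> (forall n, flat (F n)) ->
  (forall n, exact_at (tensor_map (idfun : {linear D -> D}) (ac_d F n.+1))
                      (tensor_map (idfun : {linear D -> D}) (ac_d F n))) ->
  forall i, (1 <= i)%N -> Tor_eq0 i D M.
Proof.
move=> exF flatF DF [//|i] _ P [projP exP]; move: i.
have resL := free_resolution_projective D.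
apply/(tensor_resolution_exact resL exP (fun n => projective_flat (projP n))).
exact/(tensor_resolution_exact resL exF flatF).
Qed.

End TorFlat.

Lemma bijectiveP (T U : Type) (f : T -> U) :
  bijective f <-> injective f /\ surjective f.
Proof.
split=> [[g fK gK]|[fi fs]]; first by split=> [|y]; [apply: can_inj fK | exists (g y)].
exists (fun y => projT1 (cid (fs y))) => y; last by case: cid.
by apply: fi; case: cid.
Qed.

Lemma bijective_linear_inv (A : pzRingType) (U V : lmodType A) (f : {linear U -> V}) :
  bijective f -> exists g : {linear V -> U}, cancel f g /\ cancel g f.
Proof.
case=> g fK gK.
have g_lin : linear g by move=> a x y; apply: (can_inj fK); rewrite linearP !gK.
by exists (mklin g_lin).
Qed.

(** * The unit of the tensor-Hom adjunction on flat modules *)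

Section Unit.
Variables (S R : pzRingType) (C : bimodType S R).

Lemma btensor_mu_linear (F : lmodType R) (x : F) :
  linear (fun c : C => tpure (c : rmod C) x : btensor C F).
Proof.
move=> s c d; rewrite [LHS]tpureDl; congr (_ + _).
exact/esym/btensor_scale_pure.
Qed.

Definition btensor_mu_fun (F : lmodType R) (x : F) : bhom C (btensor C F) :=
  mklin (btensor_mu_linear x).

Lemma btensor_mu_fun_linear (F : lmodType R) : linear (@btensor_mu_fun F).
Proof.
move=> a x y; apply: hom_ext => c /=; rewrite [LHS]tpureDr; congr (_ + _).
exact/esym/tpureM.
Qed.

Definition btensor_mu (F : lmodType R) : {linear F -> bhom C (btensor C F)} :=
  mklin (@btensor_mu_fun_linear F).

Section RHom.
Variable P : lmodType S.

(** Here R acts through the target [C], hence on the right; in [bhom] it acts through the source,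
    hence on the left. *)
Definition rhom : Type := hom P C.

HB.instance Definition _ := GRing.Zmodule.on rhom.

Definition rhom_scale (a : R^c) (f : rhom) : rhom := hom_post (right_homothety C a) f.

Lemma rhom_scaleA a b f : rhom_scale a (rhom_scale b f) = rhom_scale (a * b) f.
Proof. by apply: hom_ext => x /=; rewrite ractA. Qed.
Lemma rhom_scale1 : left_id 1 rhom_scale.
Proof. by move=> f; apply: hom_ext => x /=; rewrite ract1. Qed.
Lemma rhom_scaleDr : right_distributive rhom_scale +%R.
Proof. by move=> a f g; apply: hom_ext => x /=; rewrite ractDl. Qed.
Lemma rhom_scaleDl f : {morph rhom_scale^~ f : a b / a + b}.
Proof. by move=> a b; apply: hom_ext => x /=; rewrite ractDr. Qed.

HB.instance Definition _ := GRing.Zmodule_isLmodule.Build R^c rhom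
  rhom_scaleA rhom_scale1 rhom_scaleDr rhom_scaleDl.

End RHom.

Lemma rhom_map_linear (P P' : lmodType S) (g : {linear P' -> P}) :
  linear (fun f : rhom P => hom_pre g f : rhom P').
Proof. by move=> a f h; apply: hom_ext. Qed.

Definition rhom_map (P P' : lmodType S) (g : {linear P' -> P}) :
  {linear rhom P -> rhom P'} := mklin (rhom_map_linear g).

Section HomTensor.
Variable F : lmodType R.

Let theta_pure (P : lmodType S) (f : rhom P) (x : F) : hom P (btensor C F) :=
  hom_pre (f : {linear P -> C}) (btensor_mu F x).

(** Tensor evaluation, f (x) y |-> (p |-> f p (x) y). *)
Definition hom_tensor (P : lmodType S) : tensor (rhom P) F -> hom P (btensor C F) :=
  tensor_lift (@theta_pure P).

Lemma hom_tensor_balanced P : balanced (@theta_pure P).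
Proof.
split=> [x f g|f x y|a f x]; apply: hom_ext => p.
- exact: tpureDl.
- exact: tpureDr.
- exact: tpureM.
Qed.

Lemma hom_tensor_pure P (f : rhom P) (x : F) :
  hom_tensor (tpure f x) = theta_pure f x.
Proof. exact: (tensor_lift_pure (@hom_tensor_balanced P)). Qed.

HB.instance Definition _ P := GRing.isZmodMorphism.Build _ _ (@hom_tensor P)
  (tensor_lift_additive (@hom_tensor_balanced P)).

Lemma hom_tensor_natural (P P' : lmodType S) (g : {linear P' -> P}) t :
  hom_tensor (tensor_map (rhom_map g) (idfun : {linear F -> F}) t)
    = hom_pre g (hom_tensor t).
Proof.
elim/tensor_ind: t => [|x y Hx Hy|f x].
- by rewrite !raddf0; apply: hom_ext.
- by rewrite !raddfB /= Hx Hy hom_preB.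
- by rewrite tensor_map_pure !hom_tensor_pure; apply: hom_ext.
Qed.

Section DualBasis.
Variables (P : lmodType S) (n : nat) (e : 'I_n -> P).
Variable phi : 'I_n -> {linear P -> S^o}.
Hypothesis phiE : forall p, p = \sum_(i < n) (phi i p : S) *: e i.

Lemma rank_one_linear i (c : C) : linear (fun p : P => (phi i p : S) *: c).
Proof. by move=> s p q; rewrite linearP scalerDl scalerA. Qed.

Lemma rank_one_rlinear i :
  linear (fun c : rmod C => mklin (rank_one_linear i (c : C)) : rhom P).
Proof.
move=> a c d; apply: hom_ext => p /=; rewrite [LHS]scalerDr; congr (_ + _).
exact/esym/(ractZ _ (c : C)).
Qed.

(** The inverse sends [h] to the sum over i of the images of [h (e i)] under [kappa i] (x) F, where
    [kappa i] takes c to the rank one map p |-> phi_i(p) c. *)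
Lemma hom_tensor_bij_dual_basis : bijective (@hom_tensor P).
Proof.
pose kappa i : {linear rmod C -> rhom P} := mklin (rank_one_rlinear i).
pose g (h : hom P (btensor C F)) : tensor (rhom P) F :=
  \sum_(i < n) tensor_map (kappa i) (idfun : {linear F -> F}) (h (e i)).
have kE i (t : btensor C F) p :
    hom_tensor (tensor_map (kappa i) (idfun : {linear F -> F}) t) p = (phi i p : S) *: t.
  elim/btensor_ind: t => [|x y Hx Hy|c x].
  - by rewrite !raddf0.
  - rewrite !raddfB; exact: (f_equal2 (fun u v => u - v) Hx Hy).
  - rewrite tensor_map_pure hom_tensor_pure; exact/esym/btensor_scale_pure.
have evB p : zmod_morphism (fun h : hom P (btensor C F) => h p) by [].
pose ev p := HB.pack_for {additive hom P (btensor C F) -> btensor C F}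
  (fun h : hom P (btensor C F) => h p) (GRing.isZmodMorphism.Build _ _ _ (evB p)).
exists g => [t|h]; last first.
  apply: hom_ext => p; rewrite /g raddf_sum [LHS](raddf_sum (ev p)) /=.
  rewrite [in RHS](phiE p) linear_sum; apply: eq_bigr => i _.
  by rewrite kE linearZ.
have gB : zmod_morphism g.
  by move=> u v; rewrite /g -sumrB; apply: eq_bigr => i _; rewrite raddfB.
have hB : zmod_morphism (@hom_tensor P) by apply: raddfB.
apply: (tensor_map_ext (h := g \o @hom_tensor P) (h' := id)) => [u v|//|f x].
  by rewrite /= hB gB.
rewrite /= hom_tensor_pure /g.
transitivity (\sum_(i < n) tpure (kappa i (f (e i)) : rhom P) x).
  by apply: eq_bigr => i _; apply: tensor_map_pure.
rewrite -tpure_suml; congr (tpure _ x); apply: hom_ext => p.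
have evB' : zmod_morphism (fun h : rhom P => h p) by [].
pose ev' := HB.pack_for {additive rhom P -> C}
  (fun h : rhom P => h p) (GRing.isZmodMorphism.Build _ _ _ evB').
rewrite [LHS](raddf_sum ev') [in RHS](phiE p) linear_sum.
by apply: eq_bigr => i _; rewrite linearZ.
Qed.

End DualBasis.

Lemma hom_tensor_bij_projective (P : lmodType S) :
  projective P -> finitely_generated P -> bijective (@hom_tensor P).
Proof.
move=> projP fgP; have [n [e [phi phiE]]] := projective_fg_basis projP fgP.
exact: hom_tensor_bij_dual_basis phiE.
Qed.

Hypothesis flatF : flat F.

(** A five lemma argument on P_1 -> P_0 -> M -> 0: Hom(-, C) (x) F and Hom(-, C (x) F) are both left
    exact, the former by flatness of [F], and they agree on P_0 and P_1. *)
Lemma hom_tensor_bij_finite_presentation (M : lmodType S) (P : aug_chain M) :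
  degreewise_finite_resolution P -> bijective (@hom_tensor M).
Proof.
case=> -[projP [eps_surj ex0 _]] fgP.
have bij n : bijective (@hom_tensor (P n)).
  by apply: hom_tensor_bij_projective; [apply: projP | apply: fgP].
have [inj0 surj0] := (bijectiveP _).1 (bij 0).
have [inj1 _] := (bijectiveP _).1 (bij 1).
have exl : exact_at (rhom_map (ac_eps P)) (rhom_map (ac_d P 0)).
  move=> u; split=> [u0|[v <-]].
    have [x|v vE] := @exact_factor _ _ _ _ _ _ _ u eps_surj ex0.
      exact: (congr1 (fun h : hom (P 1) C => h x) u0).
    by exists v; apply: hom_ext.
  by apply: hom_ext => x; rewrite /= ac_epsd linear0.
(* Injectivity is phrased as exactness after a zero map so that flatness preserves it. *)
have exl0 : exact_at (\0 : {linear rhom M -> rhom M}) (rhom_map (ac_eps P)).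
  move=> u; split=> [u0|[v <-]]; last exact: linear0.
  by exists u; apply/esym/(hom_pre_injective eps_surj).
apply/bijectiveP; split.
  move=> s t st; apply/eqP; rewrite -subr_eq0; apply/eqP.
  have st0 : hom_tensor (s - t) = 0 by rewrite raddfB /= st subrr.
  have /(flatF exl0)[u <-] :
      tensor_map (rhom_map (ac_eps P)) (idfun : {linear F -> F}) (s - t) = 0.
    by apply: inj0; rewrite hom_tensor_natural st0 raddf0; apply: hom_ext.
  elim/tensor_ind: u => [|u v Hu Hv|f x]; first by rewrite raddf0.
    by rewrite raddfB /= Hu Hv subrr.
  rewrite tensor_map_pure; apply: (addIr (tpure 0 x)).
  by rewrite add0r -tpureDl addr0.
move=> h; have [t0 t0E] := surj0 (hom_pre (ac_eps P) h).
have /(flatF exl)[t tE] :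
    tensor_map (rhom_map (ac_d P 0)) (idfun : {linear F -> F}) t0 = 0.
  apply: inj1; rewrite hom_tensor_natural t0E raddf0.
  by apply: hom_ext => x; rewrite /= ac_epsd linear0.
exists t; apply/eqP; rewrite -subr_eq0; apply/eqP/(hom_pre_injective eps_surj).
by rewrite hom_preB -hom_tensor_natural tE t0E subrr.
Qed.

(** The unit is the composite F = R (x) F = Hom_S(C, C) (x) F -> Hom_S(C, C (x) F) of the homothety
    isomorphism and tensor evaluation. *)
Lemma btensor_mu_bij : semidualizing C -> bijective (btensor_mu F).
Proof.
case=> [[P resP] _ _ rho_bij _ _].
have [tinj tsurj] := (bijectiveP _).1 (hom_tensor_bij_finite_presentation resP).
have [rinj _] := (bijectiveP _).1 rho_bij.
case: rho_bij => r rhoK rK.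
have rE (a : R) x : hom_tensor (tpure (right_homothety C a : rhom C) x)
    = btensor_mu F (a *: x).
  by rewrite hom_tensor_pure; apply: hom_ext => c; apply: tpureM.
(* This induces the map Hom_S(C, C) (x) F -> F that undoes the first identification. *)
pose b (f : rhom C) (z : F) : F := r f *: z.
have bbal : balanced b.
  split=> [z f g|f z w|a f z]; rewrite /b.
- rewrite -scalerDl; congr (_ *: z); apply: rinj; rewrite rK; apply: hom_ext => c.
  by rewrite /= ractDr -[f in LHS]rK -[g in LHS]rK.
- exact: scalerDr.
- rewrite scalerA; congr (_ *: z); apply: rinj; rewrite rK; apply: hom_ext => c.
  by rewrite -[f in LHS]rK /= ractA.
have bB := tensor_lift_additive bbal.
apply/bijectiveP; split=> [x y|h].
  rewrite -[x]scale1r -[y]scale1r -!rE => /tinj/(congr1 (tensor_lift b)).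
  by rewrite !tensor_lift_pure // /b rhoK.
have [t <-] := tsurj h; elim/tensor_ind: t => [|t u [x xE] [y yE]|f x].
- by exists 0; rewrite linear0 raddf0.
- by exists (x - y); rewrite linearB xE yE raddfB.
- by exists (r f *: x); rewrite -rE rK.
Qed.

End HomTensor.
End Unit.

(** * Transport along isomorphisms *)

Lemma exact_at_bij (X X' Y Y' : Type) (Z Z' : nmodType) (f : X -> Y) (g : Y -> Z)
    (f' : X' -> Y') (g' : Y' -> Z') (al : X -> X') (be : Y -> Y') (ga : Z -> Z') :
  bijective al -> bijective be -> (forall z, ga z = 0 <-> z = 0) ->
  (forall x, be (f x) = f' (al x)) -> (forall y, ga (g y) = g' (be y)) ->
  exact_at f g <-> exact_at f' g'.
Proof.
move=> [al' alK alK'] [be' beK beK'] ga0 cf cg.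
have g0 y : g y = 0 <-> g' (be y) = 0 by rewrite -cg; apply: iff_sym.
have imf y : (exists x, f x = y) <-> exists x, f' x = be y.
  split=> [[x <-]|[x xE]]; first by exists (al x).
  by exists (al' x); apply: (can_inj beK); rewrite cf alK'.
split=> ex y; last by apply: iff_trans (iff_trans (ex (be y)) _); [|apply: iff_sym].
rewrite -[y]beK'; apply: iff_trans (iff_trans (ex (be' y)) _) => //.
exact: iff_sym.
Qed.

Lemma linear_eq0 (A : pzRingType) (U V : lmodType A) (f : {linear U -> V}) :
  injective f -> forall x, f x = 0 <-> x = 0.
Proof. by move=> fi x; split=> [|->]; rewrite ?linear0 // -(linear0 f) => /fi. Qed.

Section Isomorphisms.
Variable A : pzRingType.

Lemma lmod_iso_sym (U V : lmodType A) : lmod_iso U V -> lmod_iso V U.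
Proof.
by case=> f /bijective_linear_inv[g [fK gK]]; exists g; exists f.
Qed.

Lemma lmod_iso_trans (U V W : lmodType A) :
  lmod_iso U V -> lmod_iso V W -> lmod_iso U W.
Proof. by case=> f fb [g gb]; exists (g \o f); apply: bij_comp. Qed.

Lemma projective_iso (P Q : lmodType A) : lmod_iso P Q -> projective P -> projective Q.
Proof.
case=> f /bijective_linear_inv[g [fK gK]] projP X Y p u ps.
have [h hE] := projP _ _ p (u \o f) ps.
by exists (h \o g) => x; rewrite /= hE /= gK.
Qed.

Lemma tensor_map_id (D : lmodType A^c) (M : lmodType A) t :
  tensor_map (idfun : {linear D -> D}) (idfun : {linear M -> M}) t = t.
Proof.
elim/tensor_ind: t => [|x y Hx Hy|d m]; rewrite ?raddf0 ?raddfB ?tensor_map_pure //.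
by rewrite /= Hx Hy.
Qed.

Lemma tensor_map_comp (D D' D'' : lmodType A^c) (M M' M'' : lmodType A)
    (f : {linear D -> D'}) (f' : {linear D' -> D''})
    (g : {linear M -> M'}) (g' : {linear M' -> M''})
    (f'' : {linear D -> D''}) (g'' : {linear M -> M''}) t :
  (forall d, f'' d = f' (f d)) -> (forall m, g'' m = g' (g m)) ->
  tensor_map f' g' (tensor_map f g t) = tensor_map f'' g'' t.
Proof.
move=> fE gE; elim/tensor_ind: t => [|x y Hx Hy|d m].
- by rewrite !raddf0.
- by rewrite !raddfB /= Hx Hy.
- by rewrite !tensor_map_pure fE gE.
Qed.

Lemma tensor_map_bij (D D' : lmodType A^c) (M M' : lmodType A)
    (f : {linear D -> D'}) (g : {linear M -> M'}) :
  bijective f -> bijective g -> bijective (tensor_map f g).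
Proof.
move=> /bijective_linear_inv[f' [fK fK']] /bijective_linear_inv[g' [gK gK']].
exists (tensor_map f' g') => t.
  rewrite -[RHS]tensor_map_id; apply: tensor_map_comp => x /=; first by rewrite fK.
  by rewrite gK.
rewrite -[RHS]tensor_map_id; apply: tensor_map_comp => x /=; first by rewrite fK'.
by rewrite gK'.
Qed.

Lemma flat_iso (F G : lmodType A) : lmod_iso F G -> flat F -> flat G.
Proof.
case=> h hb flatF X Y Z f g fg.
have bb (D : lmodType A^c) : bijective (tensor_map (idfun : {linear D -> D}) h).
  by apply: tensor_map_bij => //; exists idfun.
have c (D D' : lmodType A^c) (k : {linear D -> D'}) t :
    tensor_map (idfun : {linear D' -> D'}) h
      (tensor_map k (idfun : {linear F -> F}) t)
    = tensor_map k (idfun : {linear G -> G})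
      (tensor_map (idfun : {linear D -> D}) h t).
  by rewrite (@tensor_map_comp _ _ _ _ _ _ _ _ _ _ k h) //
     (@tensor_map_comp _ _ _ _ _ _ _ _ _ _ k h).
apply/(exact_at_bij (bb X) (bb Y) _ (c _ _ f) (c _ _ g)); last exact: flatF.
move=> z; split=> [z0|->]; last exact: raddf0.
have [inj _] := (bijectiveP _).1 (bb Z).
by apply: inj; rewrite z0 raddf0.
Qed.

End Isomorphisms.

(** * Evaluation on C-flat modules *)

Section Evaluation.
Variables (S R : pzRingType) (C : bimodType S R).

Lemma btensor_map_linear (M M' : lmodType R) (f : {linear M -> M'}) :
  linear (tensor_map (idfun : {linear rmod C -> rmod C}) f :
    btensor C M -> btensor C M').
Proof.
move=> s x y; rewrite raddfD; congr (_ + _).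
by rewrite [LHS](tensor_map_comp (f'' := left_homothety C s) (g'' := f)) //
   [RHS](tensor_map_comp (f'' := left_homothety C s) (g'' := f)).
Qed.

Definition btensor_map (M M' : lmodType R) (f : {linear M -> M'}) :
  {linear btensor C M -> btensor C M'} := mklin (btensor_map_linear f).

Lemma evaluation_natural (N N' : lmodType S) (g : {linear N -> N'})
    (t : btensor C (bhom C N)) :
  evaluation (btensor_map (bhom_map C g) t) = g (evaluation t).
Proof.
elim/btensor_ind: t => [|x y Hx Hy|c f]; first by rewrite !linear0.
  rewrite !linearB; exact: (f_equal2 (fun u v => u - v) Hx Hy).
by rewrite [btensor_map _ _]tensor_map_pure !evaluation_pure.
Qed.

(** A triangle identity of the tensor-Hom adjunction. *)
Lemma evaluation_mu (F : lmodType R) (t : btensor C F) :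
  evaluation (btensor_map (btensor_mu C F) t) = t.
Proof.
elim/btensor_ind: t => [|x y Hx Hy|c x]; first by rewrite !linear0.
  rewrite !linearB; exact: (f_equal2 (fun u v => u - v) Hx Hy).
by rewrite [btensor_map _ _]tensor_map_pure evaluation_pure.
Qed.

Lemma btensor_mu_natural (F F' : lmodType R) (f : {linear F -> F'}) x :
  bhom_map C (btensor_map f) (btensor_mu C F x) = btensor_mu C F' (f x).
Proof. by apply: hom_ext => c; apply: tensor_map_pure. Qed.

Lemma bhom_map_bij (N N' : lmodType S) (g : {linear N -> N'}) :
  bijective g -> bijective (bhom_map C g).
Proof.
move=> /bijective_linear_inv[h [gK hK]].
by exists (bhom_map C h) => f; apply: hom_ext => x; rewrite /= ?gK ?hK.
Qed.

Lemma btensor_map_bij (M M' : lmodType R) (f : {linear M -> M'}) :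
  bijective f -> bijective (btensor_map f).
Proof. by move=> fb; apply: tensor_map_bij => //; exists idfun. Qed.

Hypothesis hC : semidualizing C.

(** For W = C (x) F the unit is the first isomorphism, and by the triangle identity evaluation is
    inverse to C (x) unit. Naturality carries both facts over to [W]. *)
Lemma bhom_flat_iso (F : lmodType R) (W : lmodType S) :
  flat F -> lmod_iso W (btensor C F) ->
  lmod_iso F (bhom C W) /\ bijective (@evaluation S R C W).
Proof.
move=> flatF [g gb]; have mub := btensor_mu_bij flatF hC; split.
  apply: (@lmod_iso_trans _ _ (bhom C (btensor C F))); first by exists (btensor_mu C F).
  by apply: lmod_iso_sym; exists (bhom_map C g); apply: bhom_map_bij.
have evb : bijective (@evaluation S R C (btensor C F)).
  exists (btensor_map (btensor_mu C F)) => t; last exact: evaluation_mu.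
  have [_ surj] := (bijectiveP _).1 (btensor_map_bij mub).
  by have [u <-] := surj t; rewrite evaluation_mu.
have [h [gK hK]] := bijective_linear_inv gb.
have E t : evaluation t = h (evaluation (btensor_map (bhom_map C g) t)) :> W.
  by rewrite evaluation_natural gK.
apply: (eq_bij (f := h \o @evaluation S R C _ \o btensor_map (bhom_map C g))).
  apply: bij_comp; last exact/btensor_map_bij/bhom_map_bij.
  by apply: bij_comp => //; exists g.
by move=> t; rewrite /= -E.
Qed.

End Evaluation.

(** * Bass complexes *)

Section BassComplexes.
Variables (S R : pzRingType) (C : bimodType S R).

Definition bhom_aug_chain (N : lmodType S) (W : aug_chain N) : aug_chain (bhom C N) :=
  @AugChain R (bhom C N) (fun n => bhom C (W n)) (fun n => bhom_map C (ac_d W n))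
    (bhom_map C (ac_eps W)) (fun n => bhom_map_comp0 (@ac_dd S N W n))
    (bhom_map_comp0 (@ac_epsd S N W)).

(** Evaluation is natural, so here it is an isomorphism from C (x) Hom(C, -) of the sequence to the
    sequence itself. *)
Lemma evaluation_exact (N1 N2 N3 : lmodType S) (f : {linear N1 -> N2})
    (g : {linear N2 -> N3}) :
  bijective (@evaluation S R C N1) -> bijective (@evaluation S R C N2) ->
  bijective (@evaluation S R C N3) ->
  exact_at (tensor_map (idfun : {linear rmod C -> rmod C}) (bhom_map C f))
           (tensor_map (idfun : {linear rmod C -> rmod C}) (bhom_map C g))
  <-> exact_at f g.
Proof.
move=> b1 b2 b3; apply: (exact_at_bij b1 b2 (ga := @evaluation S R C N3)).
- by apply: linear_eq0; apply: bij_inj.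
- by move=> t; rewrite -evaluation_natural.
- by move=> t; rewrite -evaluation_natural.
Qed.

Hypothesis hC : semidualizing C.

Lemma C_projective_bhom (W : lmodType S) : C_projective C W ->
  projective (bhom C W) /\ bijective (@evaluation S R C W).
Proof.
case=> P projP WP.
have [PW ev] := bhom_flat_iso hC (projective_flat projP) WP.
by split=> //; apply: projective_iso projP.
Qed.

Lemma C_projective_C_flat (W : lmodType S) : C_projective C W -> C_flat C W.
Proof. by case=> P projP WP; exists P => //; apply: projective_flat. Qed.

(* Tensoring the projective resolution Hom(C, W+) of Hom(C, N) with C gives W+
   back, because N is in the Bass class. *)
Lemma proper_resolution_exact (N : lmodType S) (W : aug_chain N) :
  Bass_class C N -> (forall n, C_projective C (W n)) ->
  hom_aug_chain_exact C W -> aug_chain_exact W.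
Proof.
move=> [_ torN evN] projW exW.
have evW n : bijective (@evaluation S R C (W n)) := (C_projective_bhom (projW n)).2.
have [surj0 ex0 exS] : aug_chain_exact (bhom_aug_chain W) by [].
have resW : projective_resolution (bhom_aug_chain W).
  by split=> // n; apply: (C_projective_bhom (projW n)).1.
split.
- move=> x; have [t tx] := ((bijectiveP _).1 evN).2 x.
  have ids : surjective (idfun : {linear rmod C -> rmod C}) by move=> c; exists c.
  have [u ut] := tensor_map_surjective ids surj0 t.
  by exists (evaluation u); rewrite -evaluation_natural -tx -ut.
(* At W_0 right exactness of the tensor product suffices; the vanishing of Tor enters from W_1
   on. *)
- by apply/evaluation_exact => //; apply: tensor_right_exact.
- by move=> n; apply/evaluation_exact => //; apply: (torN n.+1 isT _ resW).
Qed.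

(** Properness is assumed only against [C] itself. It gives the left half of Hom(C, Y), while the
    vanishing of Ext gives the right half; the joint is treated by hand. *)
Lemma Bass_complex_splice (N : lmodType S) (W : aug_chain N) (I : aug_cochain N) :
  Bass_class C N -> (forall n, C_projective C (W n)) ->
  hom_aug_chain_exact C W -> injective_coresolution I ->
  Bass_complex C (C_projective C) N (splice W I).
Proof.
move=> bN projW exCW coresI.
have [eps_surj exW0 exW] := proper_resolution_exact bN projW exCW.
have [injI [eta_inj exI0 exI]] := coresI.
have eta0 x : cc_eta I x = 0 -> x = 0 by apply: (linear_eq0 eta_inj _).1.
have [epsC_surj exCW0 exCWS] := exCW.
have exCI := (Ext_eq0_coresolution C coresI).1 (Bass_Ext bN).
split=> //.
- split=> // x; split.
  + by move=> /eta0/exW0.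
  + by case=> y <-; rewrite /= ac_epsd linear0.
  + by move=> /exI0[z <-]; have [y <-] := eps_surj z; exists y.
  + by case=> y <-; rewrite /= cc_deta.
- have [k kE] := ker_corestrict (@cc_deta _ _ I).
  exists k; apply/bijectiveP; split=> [x y /(congr1 (@ker_val _ _ _ _))|z].
    by rewrite !kE => /eta_inj.
  have /exI0[x xE] := ker_valP z.
  by exists x; apply: val_inj; rewrite /= kE.
- split=> //.
  + move=> f; split=> [f0|[g <-]]; last first.
      by apply: hom_ext => x; rewrite /= ac_epsd linear0.
    apply/exCW0; apply: hom_ext => x; apply: eta0.
    exact: (congr1 (fun h : hom C (I 0) => h x) f0).
  (* A cycle [f] has values in the kernel, which is N; it therefore factors through [cc_eta I], and
     the factor lifts to W_0 by properness. *)
  + move=> f; split=> [f0|[g <-]]; last first.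
      by apply: hom_ext => x; rewrite /= cc_deta.
    have [x|v vE] := @exact_lift _ _ _ _ _ _ _ f eta_inj exI0.
      exact: (congr1 (fun h : hom C (I 1) => h x) f0).
    have [g gE] := epsC_surj v; exists g; apply: hom_ext => x /=.
    by rewrite -vE -gE.
Qed.

(** C = C (x) R, which allows properness to be tested against [C]. *)
Lemma C_projective_regular : C_projective C C.
Proof.
have one_proj : projective (R^o : lmodType R).
  move=> X Y p f ps; have [x xE] := ps (f 1).
  have x_lin : linear (fun a : R^o => (a : R) *: x).
    by move=> a b c; rewrite scalerDl scalerA.
  exists (mklin x_lin) => a /=.
  by rewrite linearZ xE -linearZ; congr (f _); apply: mulr1.
exists R^o => //.
exists (btensor_mu C R^o (1 : R)).
have bbal : balanced (fun (c : rmod C) (a : R^o) => ract (c : C) a : C).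
  split=> [a c d|c a b|a c b]; [exact: ractDl|exact: ractDr|exact: ractA].
exists (tensor_lift (fun (c : rmod C) (a : R^o) => ract (c : C) a : C)) => [c|t].
  by rewrite [LHS](tensor_lift_pure bbal) ract1.
pose l := tensor_lift (fun (c : rmod C) (a : R^o) => ract (c : C) a : C).
have lB : zmod_morphism l := tensor_lift_additive bbal.
apply: (tensor_map_ext (h := fun t => btensor_mu C R^o (1 : R) (l t)) (h' := id)) => //.
  by move=> x y; rewrite lB; apply: linearB.
move=> c a; rewrite /l (tensor_lift_pure bbal) /=.
by rewrite [LHS](tpureM (a : R)); congr tpure; apply: mulr1.
Qed.

(** For a free resolution F of Hom(C, N), the chain C (x) F augmented by evaluation is spliced with
    an injective coresolution. Applying Hom(C, -) to this chain returns F through the unit, whence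
    the exactness required. *)
Lemma Bass_complex_exists (N : lmodType S) :
  Bass_class C N -> exists Y, Bass_complex C (C_projective C) N Y.
Proof.
move=> bN.
have [F [projF [eps_surj ex0 exS]]] :
    exists F : aug_chain (bhom C N), projective_resolution F.
  by exists (free_resolution (bhom C N)); apply: free_resolution_projective.
have mub n : bijective (btensor_mu C (F n)).
  exact: btensor_mu_bij (projective_flat (projF n)) hC.
pose eps : {linear btensor C (F 0) -> N} :=
  @evaluation S R C N \o btensor_map C (ac_eps F).
have dd n x : btensor_map C (ac_d F n) (btensor_map C (ac_d F n.+1) x) = 0.
  elim/btensor_ind: x => [|x y Hx Hy|c x]; first by rewrite !linear0.
    rewrite !linearB [LHS](f_equal2 (fun u v => u - v) Hx Hy); exact: subrr.
  rewrite [X in btensor_map _ _ X]tensor_map_pure [LHS]tensor_map_pure ac_dd.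
  by apply: (addIr (tpure (c : rmod C) 0)); rewrite add0r -tpureDr addr0.
have epsd x : eps (btensor_map C (ac_d F 0) x) = 0.
  elim/btensor_ind: x => [|x y Hx Hy|c x]; first by rewrite !linear0.
    rewrite !linearB [LHS](f_equal2 (fun u v => u - v) Hx Hy); exact: subrr.
  rewrite [X in eps X]tensor_map_pure /eps /=.
  by rewrite [X in evaluation X]tensor_map_pure evaluation_pure ac_epsd.
pose W := @AugChain S N (fun n => btensor C (F n)) (fun n => btensor_map C (ac_d F n))
  eps dd epsd.
have [I coresI] := injective_coresolution_exists N.
(* The unit is compatible with the augmentations; this is the other triangle identity. *)
have epsE x : bhom_map C eps (btensor_mu C (F 0) x) = ac_eps F x.
  apply: hom_ext => c; rewrite /eps /=.
  by rewrite [X in evaluation X]tensor_map_pure evaluation_pure.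
exists (splice W I); apply: Bass_complex_splice => //.
- by move=> n; exists (F n) => //; exists idfun; exists idfun.
- split.
  + move=> f; have [x xE] := eps_surj f; exists (btensor_mu C (F 0) x).
    by rewrite -[LHS]/(bhom_map C eps (btensor_mu C (F 0) x)) epsE.
  + apply/(exact_at_bij (f := ac_d F 0) (g := ac_eps F) (mub 1) (mub 0) (ga := id)) => //.
    * exact: (fun x => esym (btensor_mu_natural C _ x)).
    * exact: (fun x => esym (epsE x)).
  + move=> n; apply/(exact_at_bij (f := ac_d F n.+1) (g := ac_d F n)
      (mub n.+2) (mub n.+1) (ga := btensor_mu C (F n))).
    * exact: linear_eq0 (bij_inj (mub n)).
    * exact: (fun x => esym (btensor_mu_natural C _ x)).
    * exact: (fun x => esym (btensor_mu_natural C _ x)).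
    * exact: exS.
Qed.

Lemma Bass_complex_Bass_class (N : lmodType S) (Y : two_sided S) :
  Bass_complex C (C_flat C) N Y -> Bass_class C N.
Proof.
case=> -[exW exWd exdI exI] injI flatW [k kb] [exCW exCWd exCdI exCI].
have [kinj ksurj] := (bijectiveP _).1 kb.
pose eta : {linear N -> ts_I Y 0} := ker_incl (ts_dI Y 0) \o k.
have eta_inj : injective eta by move=> x y /val_inj/kinj.
have eta0 x : eta x = 0 -> x = 0 by apply: (linear_eq0 eta_inj _).1.
have deta x : ts_dI Y 0 (eta x) = 0 by apply: ker_valP.
have exeta : exact_at eta (ts_dI Y 0).
  move=> y; split=> [y0|[x <-] //].
  have yk : ker_pred (ts_dI Y 0) y by apply/eqP.
  by have [x xE] := ksurj (Ker yk); exists x; rewrite /eta /= xE.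
pose I := @AugCochain S N (ts_I Y) (ts_dI Y) eta (@ts_dIdI S Y) deta.
have coresI : injective_coresolution I by [].
(* The middle map of [Y] lands in the kernel, a copy of N, and so splits as [eta] after an
   augmentation W_0 -> N. *)
have [eps epsE] := exact_lift eta_inj exeta (@ts_dId S Y).
have epsd x : eps (ts_dW Y 0 x) = 0 by apply: eta0; rewrite epsE ts_ddW.
pose W := @AugChain S N (ts_W Y) (ts_dW Y) eps (@ts_dWdW S Y) epsd.
have exW0 : exact_at (ts_dW Y 0) eps.
  move=> y; split=> [y0|[x <-] //].
  by apply/exWd; rewrite -epsE y0 linear0.
have resM : aug_chain_exact (bhom_aug_chain W).
  split=> //.
  (* Composed with [eta], a map C -> N becomes a cycle of Hom(C, Y), so it comes from a map C ->
     W_0. *)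
  - move=> f; have [|g gE] := (exCdI (hom_post eta f)).1.
      by apply: hom_ext => x; apply: deta.
    exists g; apply: hom_ext => x; apply: eta_inj; apply: etrans (epsE (g x)) _.
    exact: (congr1 (fun h : hom C (ts_I Y 0) => h x) gE).
  - move=> f; split=> [f0|[g <-]]; last by apply: hom_ext => x; apply: epsd.
    apply/exCWd; apply: hom_ext => x; apply: etrans (esym (epsE (f x))) _.
    have fx0 : eps (f x) = 0 := congr1 (fun h : hom C N => h x) f0.
    by rewrite fx0 linear0.
have WE n : flat (bhom C (ts_W Y n)) /\ bijective (@evaluation S R C (ts_W Y n)).
  have [F flatF WF] := flatW n; have [FW ev] := bhom_flat_iso hC flatF WF.
  by split=> //; apply: flat_iso flatF.
have evW n := (WE n).2.
split.
- exact: (Ext_eq0_coresolution C coresI).2.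
- apply: (Tor_eq0_flat_resolution resM) => [n|n]; first exact: (WE n).1.
  exact: (evaluation_exact _ _ (evW n.+2) (evW n.+1) (evW n)).2.
- have [eps_surj eps_ex _] := resM.
  have ids : surjective (idfun : {linear rmod C -> rmod C}) by move=> c; exists c.
  apply/bijectiveP; split=> [s t st|x].
    apply/eqP; rewrite -subr_eq0; apply/eqP; set u := s - t.
    have u0 : evaluation u = 0.
      by rewrite linearB; apply/eqP; rewrite subr_eq0; apply/eqP/st.
    (* An element [u] killed by evaluation is lifted to C (x) Hom(C, W_0). The lift evaluates into
       the image of W_1, hence comes from C (x) Hom(C, W_1), and so maps to 0. *)
    have [w wu] := tensor_map_surjective ids eps_surj u.
    have /exW0[y yE] : eps (evaluation w) = 0.
      by rewrite -evaluation_natural -u0; congr (evaluation _).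
    have [y' y'E] := ((bijectiveP _).1 (evW 1)).2 y.
    have wE : w = btensor_map C (bhom_map C (ts_dW Y 0)) y'.
      by apply: (bij_inj (evW 0)); rewrite evaluation_natural y'E yE.
    rewrite -wu wE.
    exact: (exact_at_comp0 y' (tensor_right_exact (D := rmod C) eps_surj eps_ex)).
  (* Surjectivity of W_0 -> N is the exactness of [Y] at I^0. *)
  have [y yE] : exists y, eps y = x.
    have /exdI[y yE] := deta x; exists y; apply: eta_inj.
    by rewrite epsE.
  have [w wE] := ((bijectiveP _).1 (evW 0)).2 y.
  exists (btensor_map C (bhom_map C eps) w).
  by rewrite evaluation_natural wE.
Qed.

End BassComplexes.

Theorem theorem6p2 (R S : pzRingType) (C : bimodType S R)
    (hC : semidualizing C) (N : lmodType S) :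
  [/\ Bass_class C N <->
        (exists Y : two_sided S, Bass_complex C (C_projective C) N Y),
      Bass_class C N <->
        (exists Y : two_sided S, Bass_complex C (C_flat C) N Y)
    & Bass_class C N ->
        forall (W : aug_chain N) (I : aug_cochain N),
          proper_C_projective_resolution C W -> injective_coresolution I ->
          Bass_complex C (C_projective C) N (splice W I)].
Proof.
(* Through this weakening, a single converse, for C-flat modules, settles both equivalences. *)
have flatY Y : Bass_complex C (C_projective C) N Y -> Bass_complex C (C_flat C) N Y.
  by case=> *; split=> // n; apply: C_projective_C_flat.
split.
- split=> [|[Y /flatY]]; first exact: Bass_complex_exists.
  exact: Bass_complex_Bass_class.
- split=> [/(Bass_complex_exists hC)[Y /flatY]|[Y]]; first by exists Y.
  exact: Bass_complex_Bass_class.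
- move=> bN W I [projW properW]; apply: Bass_complex_splice => //.
  exact/properW/C_projective_regular.
Qed.
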